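(* Let $\mathcal{H}$ be a real Hilbert space with inner product $\langle\cdot,\cdot\rangle$ and norm $\|\cdot\|$. Let $\Phi:\mathcal{H}\to\mathbb{R}$ be a convex $C^1$ function such that $\arg\min\Phi=\{v\in\mathcal{H}:\Phi(v)=\Phi^*\}$ is nonempty, where $\Phi^*=\min_{x\in\mathcal{H}}\Phi(x)$. Let $c>0$, $\alpha\in[0,1)$, $\gamma(t)=\frac{c}{(1+t)^\alpha}$, and $g\in L^1(0,+\infty;\mathcal{H})$. Let $x\in W^{2,1}_{loc}(0,+\infty;\mathcal{H})$ be a solution of $$\ddot x(t)+\gamma(t)\dot x(t)+\nabla\Phi(x(t))=g(t),\quad t\ge 0.$$ Assume that $\int_0^{+\infty}(1+t)^{\frac{\alpha+1}{2}}\|g(t)\|\,dt<\infty$ and that $\Phi$ is even, i.e. $\Phi(-x)=\Phi(x)$ for all $x\in\mathcal{H}$. Then $x(t)$ converges strongly in $\mathcal{H}$ as $t\to+\infty$ to some $x^*\in\arg\min\Phi$.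
   Context: $W^{2,1}_{loc}(0,+\infty;\mathcal{H})$ denotes functions whose first and second (weak) derivatives are locally integrable with values in $\mathcal{H}$; $\dot x,\ddot x$ denote the first and second time derivatives. *)

(* Defs.v *)
From HB Require Import structures.
From mathcomp Require Import all_boot all_order all_algebra.
From mathcomp Require Import all_classical all_reals all_analysis.
Set Implicit Arguments. Unset Strict Implicit. Unset Printing Implicit Defensive.
Import Order.TTheory GRing.Theory Num.Theory.
Import numFieldNormedType.Exports.
Local Open Scope classical_set_scope.
Local Open Scope ring_scope.

(* [inner] is an inner product on the normed space H inducing its norm.
   Together with completeness of H this makes H a real Hilbert space. *)
Definition is_inner_product (R : realType) (H : normedModType R)
  (inner : H -> H -> R) : Prop :=
  [/\ (forall x y, inner x y = inner y x),
      (forall (a : R) (x y z : H), inner (a *: x + y) z = a * inner x z + inner y z)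
    & (forall x : H, `|x| ^+ 2 = inner x x)].

Definition convex_fun (R : realType) (H : normedModType R) (Phi : H -> R) : Prop :=
  forall (x y : H) (l : R), 0 <= l <= 1 ->
    Phi (l *: x + (1 - l) *: y) <= l * Phi x + (1 - l) * Phi y.

Definition C1_with_gradient (R : realType) (H : normedModType R)
  (inner : H -> H -> R) (Phi : H -> R) (gradPhi : H -> H) : Prop :=
  (forall x : H, differentiable Phi x /\
      forall h : H, 'd Phi x h = inner (gradPhi x) h)
  /\ continuous gradPhi.

Definition abs_cont_on (R : realType) (H : normedModType R) (f : R -> H)
  (a b : R) : Prop :=
  forall eps : R, 0 < eps -> exists2 delta : R, 0 < delta &
    forall (n : nat) (a_ b_ : 'I_n -> R),
      (forall i, a <= a_ i /\ a_ i <= b_ i /\ b_ i <= b) ->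
      (forall i j, i != j -> b_ i <= a_ j \/ b_ j <= a_ i) ->
      \sum_(i < n) (b_ i - a_ i) < delta ->
      \sum_(i < n) `|f (b_ i) - f (a_ i)| < eps.

Definition loc_abs_cont_pos (R : realType) (H : normedModType R) (f : R -> H)
  : Prop := forall a b : R, 0 < a -> a <= b -> abs_cont_on f a b.

Definition strongly_measurable_pos (R : realType) (H : normedModType R)
  (g : R -> H) : Prop :=
  exists f : nat -> R -> H,
    (forall n, finite_set (range (f n)) /\
               forall y : H, measurable (f n @^-1` [set y])) /\
    {ae (@lebesgue_measure R), forall t, 0 < t -> f n t @[n --> \oo] --> g t}.

Definition L1_pos (R : realType) (H : normedModType R) (g : R -> H) : Prop :=
  strongly_measurable_pos g /\
  (\int[(@lebesgue_measure R)]_(t in `]0%R, +oo[) (`|g t| : R)%:E < +oo)%E.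

(* x in W^{2,1}_loc(0,+oo; H) with first derivative xd : x is differentiable
   on ]0,+oo[ with derivative xd, and xd is locally absolutely continuous
   there (hence, H being a Hilbert space, xd is a.e. differentiable with a
   locally Bochner-integrable derivative). *)
Definition W21loc_pos (R : realType) (H : normedModType R) (x xd : R -> H)
  : Prop :=
  (forall t : R, 0 < t -> is_derive t 1 x (xd t)) /\ loc_abs_cont_pos xd.

(* Main.v *)
(* Write a = 1 + t, s = a^alpha, w = a^((1+alpha)/2), so that w^2 = a s, and let
   W be the integral of w |g|, which is bounded.  As Phi is even and convex, 0 is
   a minimizer.  With E = |x'|^2/2 + Phi(x) - Phi(0), the functional
     F = a s E + (1+alpha) s <x, x'> + (1+alpha)/2 (c - alpha s/a) |x|^2
   satisfies, for large t, a s E / 2 + (c/8) |x|^2 <= F and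
     F' <= - (c/2) a |x'|^2 + C (W' + s/a^2) (1 + F),
   where s/a^2 is integrable since alpha < 1.  Hence F, x, a s E and w |x'| are
   bounded, and a |x'|^2 is integrable.
   For T fixed and t <= T, evenness gives
     - <grad Phi(x t), x t + x T> <= Phi(x T) - Phi(x t)
                                  <= |x'|^2/2 + C (J T - J t),  J' = |g|/w,
   so integrating s h'' + c h' for h = |x|^2/2 + <x, x T> bounds |x t - x T|^2 by
   N t - N T + o(1) for some N bounded below.  Then x t is Cauchy, and E --> 0.

   All differential inequalities hold almost everywhere only; they are
   integrated through [ac_nonincreasing], and the integrals of |g| enter only
   through the monotone functions W and J. *)
Require Import Defs.
From HB Require Import structures.
From mathcomp Require Import all_boot all_order all_algebra.
From mathcomp Require Import all_classical all_reals all_analysis.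
From mathcomp Require Import measurable_realfun ring lra.
Import Order.TTheory GRing.Theory Num.Theory.
Import numFieldNormedType.Exports.
Local Open Scope classical_set_scope.
Local Open Scope ring_scope.

(** * Monotonicity from an almost everywhere derivative *)

(** Cousin's lemma, standing in for compactness of [a, b]. The supremum [m] of the points reached
    from [a] is itself reached by the local property at [m], which also carries past [m] unless
    [m = b]. *)
Lemma cousin (R : realType) (P : R -> R -> Prop) (a b : R) : a <= b ->
  (forall u v w, u <= v -> v <= w -> P u v -> P v w -> P u w) ->
  (forall t, a <= t -> t <= b -> exists2 d, 0 < d &
     forall u v, a <= u -> u <= t -> t <= v -> v <= b ->
       t - d < u -> v < t + d -> P u v) ->
  P a b.
Proof.
move=> ab Padd Ploc.
pose S := [set s | [/\ a <= s, s <= b & P a s]].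
have Sa : S a.
  by split => //; have [d d0] := Ploc _ (lexx a) ab; apply => //; lra.
have Sub : ubound S b by move=> s [].
have supS : has_sup S by split; [exists a | exists b].
set m := sup S.
have am : a <= m by apply: ub_le_sup => //; exists b.
have mb : m <= b by apply: ge_sup => //; exists a.
have [d d0 Pm] := Ploc _ am mb.
have [s [as_ sb Pas] ms] := sup_adherent d0 supS.
have sm : s <= m by apply: ub_le_sup => //; exists b.
have Sv : forall v, m <= v -> v <= b -> v < m + d -> P a v.
  by move=> v mv vb vd; apply: (Padd _ s) => //; [exact: le_trans mv|exact: Pm].
have [bmd|bmd] := ltP b (m + d); first exact: Sv.
suff : m + d / 2 <= m by lra.
apply: ub_le_sup; first by exists b.
by split; [lra|lra|apply: Sv; lra].
Qed.

(** Difference quotients based at [t] are below [e] near [t]. The points [u] and [v] lie on either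
    side of [t], so that the increment splits there into two such quotients. *)
Lemma derive_le_increment (R : realType) (F : R -> R) (t d e : R) :
  is_derive t 1 F d -> d < e ->
  exists2 r, 0 < r & forall u v, u <= t -> t <= v -> t - r < u -> v < t + r ->
    F v - F u <= e * (v - u).
Proof.
move=> [dF dFE] de.
have : h^-1 *: (F (h + t) - F t) @[h --> 0^'] --> d.
  have := dF; rewrite /derivable -dFE /derive.
  have -> : (fun h => h^-1 *: ((F \o shift t) (h *: 1) - F t)) =
            (fun h => h^-1 *: (F (h + t) - F t)).
    by apply/funext => h /=; rewrite [h *: 1]mulr1.
  by [].
move/cvgrPdist_lt => /(_ (e - d)); rewrite subr_gt0 => /(_ de).
move=> [r /= r0 rP]; exists r => // u v ut tv ru rv.
have step h : h != 0 -> `|h| < r -> h^-1 * (F (h + t) - F t) < e.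
  move=> h0 hr; have /= := rP h.
  rewrite sub0r normrN => /(_ hr h0).
  by rewrite ltr_distl => /andP[+ _]; rewrite /GRing.scale /=; lra.
have H1 : F v - F t <= e * (v - t).
  have [->|vt] := eqVneq v t; first by rewrite !subrr mulr0.
  have vt0 : 0 < v - t by rewrite subr_gt0 lt_neqAle eq_sym vt.
  have := step (v - t); rewrite gt_eqF// gtr0_norm// subrK => /(_ isT).
  by rewrite mulrC ltr_pdivrMr// => /(_ _)/ltW; apply; lra.
have H2 : F t - F u <= e * (t - u).
  have [->|vt] := eqVneq u t; first by rewrite !subrr mulr0.
  have vt0 : 0 < t - u by rewrite subr_gt0 lt_neqAle vt.
  have := step (u - t); rewrite subr_eq0 (negbTE vt) distrC gtr0_norm// subrK.
  have -> : (u - t)^-1 * (F u - F t) = (F t - F u) / (t - u).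
    by rewrite -[u - t]opprB invrN mulNr -mulrN opprB mulrC.
  by rewrite ltr_pdivrMr// => /(_ isT _)/ltW; apply; lra.
have -> : e * (v - u) = e * (v - t) + e * (t - u) by rewrite -mulrDr; congr (_ * _); lra.
by lra.
Qed.

(* The bad null set is covered by an open set of small measure; a partition
   adapted to the derivative at good points and to this open set at bad points
   bounds the increment of F. *)
Lemma ac_nonincreasing (R : realType) (H : normedModType R) (f : R -> H)
    (F : R -> R) (a b C : R) :
  a <= b -> 0 <= C -> abs_cont_on f a b ->
  (forall u v, a <= u -> u <= v -> v <= b ->
     F v - F u <= C * (`|f v - f u| + (v - u))) ->
  {ae (@lebesgue_measure R), forall t, a <= t -> t <= b ->
     exists2 d, d <= 0 & is_derive t 1 F d} ->
  F b <= F a.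
Proof.
move=> ab C0 fac FC [A [mA A0 badA]].
suff main e : 0 < e -> F b - F a <= e * (b - a + 2 * C).
  rewrite leNgt; apply/negP => Fab.
  have K0 : 0 < b - a + 2 * C + 1 by lra.
  have := main ((F b - F a) / (b - a + 2 * C + 1)).
  rewrite divr_gt0 ?subr_gt0// => /(_ isT).
  rewrite mulrAC ler_pdivlMr// ler_pM2l ?subr_gt0//; lra.
move=> e0; have [dl dl0 dlP] := fac _ e0.
(* One bound on the measure serves twice: [dl] triggers absolute continuity on the bad intervals and
   [e] bounds their total length, whence the term 2 C in [main]. *)
have dm0 : 0 < Num.min dl e by rewrite lt_min dl0.
have [|U [oU AU UA]] := lebesgue_regularity_outer mA _ dm0.
  by rewrite [X in (X < _)%E]A0 ltry.
have mU : measurable U by exact: open_measurable.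
have muU : (lebesgue_measure U < (Num.min dl e)%:E)%E.
  apply: le_lt_trans UA.
  rewrite -[X in (_ <= X)%E]add0e -[X in (_ <= X + _)%E]A0.
  rewrite [X in (X <= _)%E](_ : _ = lebesgue_measure (A `|` U `\` A)).
    by apply: measureU2 => //; exact: measurableD.
  by rewrite setDE setUIr setUv setIT setUidr.
(* The list [s] records the partition intervals placed around bad points. In the last clause,
   half-open intervals make the measures add up when two lists are concatenated. *)
pose P u v := exists s : seq (R * R),
  [/\ all (fun q => [&& u <= q.1, q.1 <= q.2 & q.2 <= v]) s,
      pairwise (fun p q : R * R => p.2 <= q.1) s,
      F v - F u <= e * (v - u) +
        \sum_(q <- s) C * (`|f q.2 - f q.1| + (q.2 - q.1)) &
      ((\sum_(q <- s) (q.2 - q.1))%:E <=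
        lebesgue_measure (U `&` [set` `[u, v[]))%E].
have [] : P a b.
  apply: cousin => //.
    move=> u v w uv vw [s1 [a1 p1 F1 m1]] [s2 [a2 p2 F2 m2]].
    exists (s1 ++ s2); split.
    - rewrite all_cat; apply/andP; split.
        by apply/sub_all : a1 => q /and3P[-> -> /=] /le_trans; apply.
      by apply/sub_all : a2 => q /and3P[vq -> ->]; rewrite (le_trans uv vq).
    - rewrite pairwise_cat p1 p2 !andbT; apply/allrelP => p q ps qs.
      have /and3P[_ _ pv] := allP a1 _ ps.
      have /and3P[vq _ _] := allP a2 _ qs.
      exact: le_trans pv vq.
    - rewrite big_cat/=.
      have -> : e * (w - u) = e * (w - v) + e * (v - u).
        by rewrite -mulrDr; congr (_ * _); lra.
      by move: F1 F2; lra.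
    - rewrite big_cat/= EFinD.
      rewrite (_ : U `&` _ = (U `&` [set` `[u, v[]) `|` (U `&` [set` `[v, w[])).
        rewrite measureU//; first exact: leeD.
        + by apply: measurableI.
        + by apply: measurableI.
        + apply/seteqP; split => // z [[_ +] [_ +]]; rewrite /mkset !in_itv/=.
          by move=> /andP[_ zv] /andP[vz _]; move: zv; rewrite ltNge vz.
      rewrite -setIUr; congr (_ `&` _).
      by apply: itv_bndbnd_setU => //; rewrite bnd_simp.
  move=> t at_ tb.
  have [At|At] := pselect (A t).
    have /= [r r0 rU] : nbhs t U by apply: open_nbhs_nbhs; split => //; exact: AU.
    exists r => // u v au ut tv vb ru rv.
    exists [:: (u, v)]; rewrite /= !big_seq1 /=; split => //.
    - by rewrite lexx (le_trans ut tv) lexx.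
    - have := FC u v au (le_trans ut tv) vb.
      have : 0 <= e * (v - u) by apply: mulr_ge0; lra.
      by lra.
    - rewrite (_ : U `&` _ = [set` `[u, v[]).
        rewrite lebesgue_measure_itv/= lte_fin; case: ltP => //.
        by rewrite lee_fin; lra.
      rewrite setIidr// => z /=; rewrite in_itv/= => /andP[uz zv].
      by apply: rU; rewrite /ball/= ltr_distlC; apply/andP; split; lra.
  have : ~ ~ (a <= t -> t <= b -> exists2 d, d <= 0 & is_derive t 1 F d).
    by move=> bad; apply: At; exact: badA.
  move=> /contrapT/(_ at_ tb)[d d0 dF].
  have [|r r0 rF] := derive_le_increment _ _ _ _ e dF; first by lra.
  exists r => // u v au ut tv vb ru rv; exists [::].
  by rewrite /= !big_nil addr0; split => //; exact: rF.
move=> s [sab spw sF sm].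
have ssum : \sum_(q <- s) (q.2 - q.1) < Num.min dl e.
  rewrite -lte_fin; apply: le_lt_trans muU; apply: le_trans sm _.
  by apply: le_measure; rewrite ?inE//; exact: measurableI.
move: ssum; rewrite lt_min => /andP[sdl se].
have svar : \sum_(q <- s) `|f q.2 - f q.1| < e.
  rewrite big_tnth.
  apply: (dlP _ (fun i => (tnth (in_tuple s) i).1) (fun i => (tnth (in_tuple s) i).2)).
  - by move=> i; have /and3P[] := allP sab _ (mem_tnth i (in_tuple s)).
  - move=> i j ij; rewrite !(tnth_nth (0, 0))/=.
    have /(pairwiseP (0,0)) pw := spw.
    move: ij; rewrite neq_ltn => /orP[ij|ij]; [left|right];
      by apply: pw => //; rewrite inE/=; exact: ltn_ord.
  - by rewrite -(big_tnth _ _ _ xpredT (fun q : R * R => q.2 - q.1)).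
apply: (le_trans sF); rewrite -big_distrr/= big_split/=.
have := ler_wpM2l C0 (ltW se); have := ler_wpM2l C0 (ltW svar); lra.
Qed.

(** * Primitives of the forcing term *)

Lemma ae_impl (R : realType) (P Q : R -> Prop) :
  {ae (@lebesgue_measure R), forall t, P t} -> (forall t, P t -> Q t) ->
  {ae (@lebesgue_measure R), forall t, Q t}.
Proof.
move=> aP PQ; move: aP; apply: filterS PQ.
exact: (ae_filter_ringOfSetsType lebesgue_measure).
Qed.

Lemma ae_and (R : realType) (P Q : R -> Prop) :
  {ae (@lebesgue_measure R), forall t, P t} ->
  {ae (@lebesgue_measure R), forall t, Q t} ->
  {ae (@lebesgue_measure R), forall t, P t /\ Q t}.
Proof.
by apply: filterI; exact: (ae_filter_ringOfSetsType lebesgue_measure).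
Qed.

Lemma measurable_fin_range (R : realType) (H : normedModType R) (f : R -> H)
    (phi : H -> R) :
  finite_set (range f) -> (forall y, measurable (f @^-1` [set y])) ->
  measurable_fun [set: R] (phi \o f).
Proof.
move=> ff mf _ B mB; rewrite setTI.
rewrite (_ : _ @^-1` _ =
  \bigcup_(y in range f `&` [set y | B (phi y)]) (f @^-1` [set y])).
  apply: fin_bigcup_measurable => //; exact: finite_setIl.
apply/seteqP; split=> [t Bt|t [y [_ By] fty]] /=; last by rewrite fty.
by exists (f t) => //; split => //; exists t.
Qed.

(** As [g] is a limit of simple functions only almost everywhere, |g| itself may fail to be
    measurable. The substitute [G] vanishes on the exceptional null set and on t <= 0. *)
Lemma strongly_measurable_normP (R : realType) (H : normedModType R) (g : R -> H) :
  strongly_measurable_pos g ->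
  exists G : R -> R, [/\ measurable_fun [set: R] G,
    forall t, 0 <= G t <= `|g t|, forall t, t <= 0 -> G t = 0 &
    {ae (@lebesgue_measure R), forall t, 0 < t -> G t = `|g t|}].
Proof.
move=> [f [fP [Z [mZ Z0 badZ]]]].
pose D := `]0%R, +oo[%classic `\` Z.
have mD : measurable D by apply: measurableD.
exists ((fun t => `|g t|) \_ D); split.
- apply/(measurable_restrictT _ _).1 => //.
  apply: (@measurable_fun_cvg _ _ _ D (fun n t => `|f n t|)).
    move=> n; apply: (@measurable_funS _ _ _ _ setT) => //.
    by have [fr mf] := fP n; exact: (measurable_fin_range _ _ (f n) Num.norm).
  move=> t [/= + Zt]; rewrite in_itv/= andbT => t0.
  apply: (@cvg_norm _ _ _ _ _ (f ^~ t)).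
  have /contrapT : ~ ~ (0 < t -> f n t @[n --> \oo] --> g t).
    by move=> bad; apply: Zt; exact: badZ.
  exact.
- by move=> t; rewrite patchE; case: ifP; rewrite ?lexx ?normr_ge0.
- move=> t t0; rewrite patchE; case: ifPn => //; rewrite inE => -[/=].
  by rewrite in_itv/= andbT ltNge t0.
- exists Z; split => // t /=; apply: contra_notP => Zt t0.
  by rewrite patchE mem_set//; split => //=; rewrite in_itv/= t0.
Qed.

(* Unlike [ge0_le_integral], no measurability is required. *)
Lemma ge0_le_integralT (R : realType) (f1 f2 : R -> \bar R) :
  (forall t, 0 <= f1 t)%E -> (forall t, f1 t <= f2 t)%E ->
  (\int[@lebesgue_measure R]_t f1 t <= \int[@lebesgue_measure R]_t f2 t)%E.
Proof.
move=> f10 f12; rewrite !ge0_integralTE//; last first.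
  by move=> t; exact: le_trans (f12 t).
apply: ereal_sup_le => _ [h hf1 <-].
by exists h => // t; exact: le_trans (f12 t).
Qed.

(** The primitive starts at minus infinity, so the total integral bounds it; its derivative almost
    everywhere comes from Lebesgue's differentiation theorem. *)
Lemma ge0_primitiveP (R : realType) (f : R -> R) :
  (forall t, 0 <= f t) ->
  (@lebesgue_measure R).-integrable [set: R] (EFin \o f) ->
  exists F : R -> R,
  [/\ forall u v, u <= v ->
        F v - F u = (\int[@lebesgue_measure R]_(t in `]u, v]) f t)%R,
      forall u v, u <= v -> F u <= F v,
      exists K, forall t, 0 <= F t <= K &
      {ae (@lebesgue_measure R), forall t : R, is_derive t 1 F (f t)}].
Proof.
move=> f0 intf.
pose F x := (\int[@lebesgue_measure R]_(t in `]-oo, x]) f t)%R.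
have inti (D : set R) : measurable D ->
    (@lebesgue_measure R).-integrable D (EFin \o f).
  by move=> mD; apply: integrableS intf.
have Fuv u v : u <= v ->
    F v - F u = (\int[@lebesgue_measure R]_(t in `]u, v]) f t)%R.
  by move=> uv; rewrite /F Rintegral_itvB//; exact: inti.
exists F; split => //.
- by move=> u v uv; rewrite -subr_ge0 Fuv//; apply: Rintegral_ge0.
- exists (\int[@lebesgue_measure R]_t f t)%R => t.
  rewrite Rintegral_ge0//= /Rintegral fine_le//.
  + by apply: integrable_fin_num => //; exact: inti.
  + by apply: integrable_fin_num => //; exact: inti.
  + apply: ge0_subset_integral => //.
    * by case/integrableP: intf.
    * by move=> x _; rewrite lee_fin.
- have locf : locally_integrable [set: R] f.
    by apply: open_integrable_locally => //; exact: openT.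
  apply: ae_impl (@FTC1Ny R f (fun y => inti _ (measurable_itv _)) locf) _.
  move=> t [dF FE]; apply: DeriveDef => //.
  by rewrite -derive1E.
Qed.

(** [W] and [J] integrate w |g| and |g| / w. The second is integrable because w >= 1 makes it
    smaller than the first. The inequality linking them holds since w(u)^2 |g| / w <= w |g| on
    [u, v], as w is nondecreasing. *)
Lemma weighted_primitives (R : realType) (H : normedModType R) (g : R -> H)
    (w : R -> R) :
  strongly_measurable_pos g -> measurable_fun [set: R] w ->
  measurable_fun [set: R] (fun t => (w t)^-1) ->
  (forall t, 0 < t -> 1 <= w t) ->
  (forall u v, 0 < u -> u <= v -> w u <= w v) ->
  (\int[(@lebesgue_measure R)]_(t in `]0%R, +oo[) (w t * `|g t|)%:E < +oo)%E ->
  exists W J : R -> R,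
  [/\ forall u v, u <= v -> W u <= W v,
      forall u v, u <= v -> J u <= J v,
      exists K, forall t, [/\ 0 <= W t, W t <= K, 0 <= J t & J t <= K],
      forall u v, 0 < u -> u <= v -> w u ^+ 2 * (J v - J u) <= W v - W u &
      {ae (@lebesgue_measure R), forall t : R, 0 < t ->
         is_derive t 1 W (w t * `|g t|) /\ is_derive t 1 J (`|g t| / w t)}].
Proof.
move=> /strongly_measurable_normP[G [mG Gg Gneg Gae]] mw mwV w1 wmon intg.
have G0 t : 0 <= G t by have /andP[] := Gg t.
have w0 t : 0 < t -> 0 < w t by move=> /w1; exact: lt_le_trans.
pose f1 t := w t * G t; pose f2 t := G t / w t.
have f10 t : 0 <= f1 t.
  rewrite /f1; have [t0|t0] := leP t 0; first by rewrite Gneg ?mulr0.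
  by rewrite mulr_ge0// ltW// w0.
have f20 t : 0 <= f2 t.
  rewrite /f2; have [t0|t0] := leP t 0; first by rewrite Gneg ?mul0r.
  by rewrite divr_ge0// ltW// w0.
have f21 t : f2 t <= f1 t.
  rewrite /f2 /f1; have [t0|t0] := leP t 0; first by rewrite Gneg ?mul0r ?mulr0.
  rewrite ler_pdivrMr ?w0// -mulrA mulrCA ler_peMr//.
  by rewrite -[1]mulr1 ler_pM// w1.
have mf1 : measurable_fun [set: R] f1 by exact: measurable_funM.
have mf2 : measurable_fun [set: R] f2 by exact: measurable_funM.
have int1 : (@lebesgue_measure R).-integrable [set: R] (EFin \o f1).
  apply/integrableP; split; first exact/measurable_EFinP.
  apply: le_lt_trans intg.
  rewrite [leRHS]integral_mkcond.
  (* The integrand w |g| is not known to be measurable; only its domination of [f1] is used. *)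
  apply: ge0_le_integralT => // t /=; rewrite ger0_norm// patchE; case: ifPn.
    rewrite inE/= in_itv/= andbT => t0; rewrite lee_fin /f1 ler_pM2l ?w0//.
    by have /andP[] := Gg t.
  rewrite notin_setE/= in_itv/= andbT => /negP; rewrite -leNgt => t0.
  by rewrite /f1 Gneg// mulr0.
have int2 : (@lebesgue_measure R).-integrable [set: R] (EFin \o f2).
  apply: le_integrable int1 => //; first exact/measurable_EFinP.
  by move=> t _ /=; rewrite !ger0_norm// lee_fin.
have [W [Wuv Wmon [K1 WK] Wae]] := ge0_primitiveP _ f1 f10 int1.
have [J [Juv Jmon [K2 JK] Jae]] := ge0_primitiveP _ f2 f20 int2.
exists W, J; split => //.
- exists (Num.max K1 K2) => t; have /andP[-> ?] := WK t.
  by have /andP[-> ?] := JK t; rewrite !le_max; split => //; apply/orP; [left|right].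
- move=> u v u0 uv; rewrite Wuv// Juv// -RintegralZl//; last first.
    exact: integrableS int2.
  apply: le_Rintegral => //.
  + rewrite (_ : EFin \o _ = fun t => ((w u ^+ 2)%:E * (EFin \o f2) t)%E)//.
    by apply: integrableZl => //; exact: integrableS int2.
  + exact: integrableS int1.
  + move=> t /=; rewrite in_itv/= => /andP[ut tv].
    have t0 : 0 < t := lt_trans u0 ut.
    rewrite /f1 /f2 mulrCA mulrC ler_wpM2r//.
    rewrite ler_pdivrMr ?w0// expr2 ler_pM//; try exact/ltW/w0.
      by apply: wmon => //; exact: ltW.
    by apply: wmon => //; exact: ltW.
- apply: ae_impl (ae_and _ _ _ Gae (ae_and _ _ _ Wae Jae)) _.
  by move=> t [GE [Wt Jt]] t0; rewrite -GE.
Qed.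

(** * Inner products and gradients *)

Section Inner.
Context {R : realType} {H : normedModType R} (inner : H -> H -> R).
Hypothesis inn : is_inner_product inner.

Lemma innerC x y : inner x y = inner y x. Proof. by case: inn. Qed.

Lemma inner_norm x : inner x x = `|x| ^+ 2. Proof. by case: inn. Qed.

Lemma innerDl x y z : inner (x + y) z = inner x z + inner y z.
Proof. by case: inn => _ L _; have := L 1 x y z; rewrite scale1r mul1r. Qed.

Lemma inner0l z : inner 0 z = 0.
Proof. by have := innerDl 0 0 z; rewrite addr0 => /eqP; rewrite -subr_eq subrr eq_sym => /eqP. Qed.

Lemma innerZl a x z : inner (a *: x) z = a * inner x z.
Proof. by case: inn => _ L _; have := L a x 0 z; rewrite inner0l !addr0. Qed.

Lemma innerNl x z : inner (- x) z = - inner x z.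
Proof. by rewrite -scaleN1r innerZl mulN1r. Qed.

Lemma innerBl x y z : inner (x - y) z = inner x z - inner y z.
Proof. by rewrite innerDl innerNl. Qed.

Lemma innerDr x y z : inner z (x + y) = inner z x + inner z y.
Proof. by rewrite innerC innerDl ![inner _ z]innerC. Qed.

Lemma innerZr a x z : inner z (a *: x) = a * inner z x.
Proof. by rewrite innerC innerZl [inner _ z]innerC. Qed.

Lemma innerNr x z : inner z (- x) = - inner z x.
Proof. by rewrite innerC innerNl [inner _ z]innerC. Qed.

Definition innerE := (innerDl, innerNl, innerZl, innerDr, innerNr, innerZr).

Lemma inner_le_norm x y : inner x y <= `|x| * `|y|.
Proof.
have [->|y0] := eqVneq y 0; first by rewrite innerC inner0l normr0 mulr0.
have [->|x0] := eqVneq x 0; first by rewrite inner0l normr0 mul0r.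
(* Expanding this square and dividing by |x| |y| gives the Cauchy-Schwarz inequality. *)
have := sqr_ge0 (`| (`|y| *: x - `|x| *: y) |).

rewrite -inner_norm !innerE !inner_norm (innerC y x).
have xy : 0 < `|x| * `|y| by rewrite mulr_gt0 ?normr_gt0.
move: (inner x y) => i H1; rewrite -(ler_pM2l xy); nra.
Qed.

Lemma norm_inner_le x y : `|inner x y| <= `|x| * `|y|.
Proof.
rewrite ler_norml inner_le_norm andbT lerNl -innerNl.
by rewrite (le_trans (inner_le_norm _ _))// normrN.
Qed.

(** Polarization reduces the continuity of the inner product to that of the norm. *)
Lemma inner_polar x y :
  inner x y = (`|x + y| ^+ 2 - `|x| ^+ 2 - `|y| ^+ 2) / 2.
Proof. by rewrite -!inner_norm !innerE (innerC y x); lra. Qed.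

Lemma cvg_inner (T : Type) (F : set_system T) (FF : Filter F)
    (f g : T -> H) (a b : H) :
  f @ F --> a -> g @ F --> b -> inner (f t) (g t) @[t --> F] --> inner a b.
Proof.
move=> fa gb; rewrite inner_polar.
under eq_fun do rewrite inner_polar.
apply: cvgMr_tmp; apply: cvgB; first apply: cvgB.
- by apply: (@cvg_comp _ _ _ _ (fun r : R => r ^+ 2)) (@exprn_continuous _ 2 _);
    apply: cvg_norm; exact: cvgD.
- by apply: (@cvg_comp _ _ _ _ (fun r : R => r ^+ 2)) (@exprn_continuous _ 2 _);
    apply: cvg_norm.
- by apply: (@cvg_comp _ _ _ _ (fun r : R => r ^+ 2)) (@exprn_continuous _ 2 _);
    apply: cvg_norm.
Qed.

End Inner.

Lemma is_derive_cvgP (R : realType) (V : normedModType R) (f : R -> V)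
    (t : R) (df : V) :
  is_derive t 1 f df <-> h^-1 *: (f (h + t) - f t) @[h --> 0^'] --> df.
Proof.
have E : (fun h => h^-1 *: ((f \o shift t) (h *: 1) - f t)) =
         (fun h => h^-1 *: (f (h + t) - f t)).
  by apply/funext => h /=; rewrite [h *: 1]mulr1.
split=> [[dF <-]|cf]; first by rewrite -E; exact: dF.
apply: DeriveDef; first by apply/cvg_ex; exists df; rewrite E.
by apply: cvg_lim => //; rewrite E.
Qed.

Lemma is_derive_continuous (R : realType) (V : normedModType R) (f : R -> V)
    (t : R) (df : V) : is_derive t 1 f df -> {for t, continuous f}.
Proof. by move=> [dF _]; apply/differentiable_continuous/derivable1_diffP. Qed.

Lemma is_derive_inner (R : realType) (H : normedModType R) (inner : H -> H -> R)
    (u v : R -> H) (t : R) (du dv : H) : is_inner_product inner ->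
  is_derive t 1 u du -> is_derive t 1 v dv ->
  is_derive t 1 (fun s => inner (u s) (v s)) (inner du (v t) + inner (u t) dv).
Proof.
move=> inn du' dv'; apply/is_derive_cvgP.
have -> : (fun h => h^-1 *: (inner (u (h + t)) (v (h + t)) - inner (u t) (v t))) =
  (fun h => inner (h^-1 *: (u (h + t) - u t)) (v (h + t)) +
            inner (u t) (h^-1 *: (v (h + t) - v t))).
  apply/funext => h; rewrite !(innerE _ inn) /GRing.scale/= -mulrDr.
  by congr (_ * _); ring.
have vt : v (h + t) @[h --> 0^'] --> v t.
  apply: (@cvg_comp _ _ _ (fun h => h + t) v _ (nbhs t)).
    apply: cvg_within_filter; rewrite -[in X in _ --> X](add0r t).
    by apply: cvgD; [exact: cvg_id|exact: cvg_cst].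
  exact: is_derive_continuous dv'.
apply: cvgD; apply: cvg_inner => //; first exact/is_derive_cvgP.
  exact: cvg_cst.
exact/is_derive_cvgP.
Qed.

Section Gradient.
Context {R : realType} {H : normedModType R} {inner : H -> H -> R}
  {Phi : H -> R} {gradPhi : H -> H}.
Hypothesis Phi1 : C1_with_gradient inner Phi gradPhi.

Lemma is_derive_gradient_comp (x : R -> H) (t : R) (dx : H) :
  is_derive t 1 x dx ->
  is_derive t 1 (fun s => Phi (x s)) (inner (gradPhi (x t)) dx).
Proof.
move=> [dX <-]; have [dPhi dPhiE] := Phi1.1 (x t).
have diffx : differentiable x t by exact/derivable1_diffP.
apply: DeriveDef; first by apply/diff_derivable; exact: differentiable_comp.
rewrite deriveE; last exact: differentiable_comp.
by rewrite diff_comp//= dPhiE deriveE.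
Qed.

Hypothesis cPhi : convex_fun Phi.

(** Along the segment from [x] to [y], convexity bounds the difference quotients of [Phi] at [x] by
    Phi y - Phi x, and these quotients tend to the left-hand side. *)
Lemma convex_gradient_le (x y : H) : inner (gradPhi x) (y - x) <= Phi y - Phi x.
Proof.
set d := inner _ _; rewrite -lerN2; apply/ler_addgt0Pl => e e0.
pose p s := s *: (y - x) + x.
have dp : is_derive (0:R) 1 p (y - x).
  apply/is_derive_cvgP; rewrite /p.
  apply: cvg_trans (@cvg_cst _ (y - x) _ (0 : R)^' _).
  apply: near_eq_cvg; near=> h; rewrite addr0 scale0r add0r addrK scalerA.
  by rewrite mulVf ?scale1r//; near: h; exact: nbhs_dnbhs_neq.
have p0 : p 0 = x by rewrite /p scale0r add0r.
(* The sign is changed because [derive_le_increment] bounds increments from above, while a lower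
   bound for the increment of [Phi] is wanted. *)
have : is_derive (0:R) 1 (fun s => - Phi (p s)) (- d).
  by rewrite /d -{1}p0; apply: is_deriveN; exact: is_derive_gradient_comp.
move=> /derive_le_increment-/(_ (- d + e))[|r r0 rP]; first by lra.
pose s := Num.min 1 (r / 2).
have s0 : 0 < s by rewrite lt_min ltr01 divr_gt0.
have s1 : s <= 1 by rewrite ge_min lexx.
have sr : s < r by rewrite gt_min ltr_pdivrMr// ltr_pMr// ltr1n orbT.
have := rP 0 s (lexx _) (ltW s0); rewrite subr0 sub0r add0r.
rewrite oppr_lt0 => /(_ r0 sr); rewrite p0.
have /(_ y x s) := cPhi; rewrite (ltW s0) s1 => /(_ isT).
have -> : s *: y + (1 - s) *: x = p s.
  by rewrite /p scalerBr scalerBl scale1r [RHS]addrAC -addrA.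
move=> H1 H2.
have : s * - (Phi y - Phi x) <= s * (- d + e) by lra.
by rewrite ler_pM2l//; lra.
Unshelve. all: by end_near. Qed.

End Gradient.

(** * Bounds and Lipschitz estimates on segments *)

Lemma ac_continuous (R : realType) (H : normedModType R) (f : R -> H) (t : R) :
  loc_abs_cont_pos f -> 0 < t -> {for t, continuous f}.
Proof.
move=> fac t0; apply/cvgrPdist_lt => e e0.
have [||d d0 dP] := fac (t / 2) (t + 1) _ _ e e0; [lra|lra|].
pose r := Num.min d (Num.min (t / 2) 1).
have r0 : 0 < r by rewrite !lt_min d0 ltr01 divr_gt0.
exists r => //= s /=; rewrite ltr_distlC => /andP[]; rewrite ltrBlDl => st1 st2.
have rd : r <= d by rewrite ge_min lexx.
have rt : r <= t / 2 by rewrite !ge_min lexx orbT.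
have r1 : r <= 1 by rewrite !ge_min lexx !orbT.
have [ts|ts] := leP t s.
  have := dP 1%N (fun=> t) (fun=> s); rewrite !big_ord1 distrC; apply.
  - by move=> _; repeat split => //; lra.
  - by move=> i j; rewrite !ord1.
  - lra.
have := dP 1%N (fun=> s) (fun=> t); rewrite !big_ord1; apply.
- by move=> _; repeat split => //; lra.
- by move=> i j; rewrite !ord1.
- lra.
Qed.

(** Boundedness is local by continuity and passes to the union of adjacent segments, so [cousin]
    applies. *)
Lemma continuous_segment_bounded (R : realType) (V : normedModType R)
    (f : R -> V) (a b : R) : a <= b ->
  (forall t, a <= t -> t <= b -> {for t, continuous f}) ->
  exists2 K, 0 <= K & forall t, a <= t -> t <= b -> `|f t| <= K.
Proof.
move=> ab cf.
apply: (cousin _ (fun u v => exists2 K, 0 <= K &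
   forall t, u <= t -> t <= v -> `|f t| <= K)) => //.
  move=> u v w uv vw [K1 K10 K1P] [K2 K20 K2P].
  exists (K1 + K2) => [|t ut tw]; first exact: addr_ge0.
  by have [tv|/ltW vt] := leP t v; [have := K1P t ut tv|have := K2P t vt tw]; lra.
move=> t at_ tb; have /cvgrPdist_lt/(_ 1 ltr01)[r /= r0 rP] := cf t at_ tb.
exists r => // u v au ut tv vb ru rv; exists (`|f t| + 1) => [|s us sv].
  by have := normr_ge0 (f t); lra.
have := rP s; rewrite /= ltr_distlC => /(_ _)/ltW.
have -> : t - r < s < t + r by apply/andP; split; lra.
by move=> /(_ isT); have := lerB_dist (f s) (f t); rewrite distrC; lra.
Qed.

Lemma derive_bounded_lipschitz (R : realType) (F dF : R -> R) (a b K : R) :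
  (forall t, a <= t -> t <= b -> is_derive t 1 F (dF t)) ->
  (forall t, a <= t -> t <= b -> `|dF t| <= K) ->
  forall u v, a <= u -> u <= v -> v <= b -> `|F v - F u| <= K * (v - u).
Proof.
move=> dFP dFK u v au uv vb.
have [||z] := @MVT_segment R F dF u v uv.
- by move=> t; rewrite in_itv/= => /andP[ut tv]; apply: dFP; lra.
- apply: continuous_in_subspaceT => t; rewrite inE/= in_itv/= => /andP[ut tv].
  by apply: is_derive_continuous (dFP t _ _); lra.
rewrite in_itv/= => /andP[uz zv] ->; rewrite normrM [X in _ * X]ger0_norm ?subr_ge0//.
by apply: ler_wpM2r; [rewrite subr_ge0|apply: dFK; lra].
Qed.

(** The scalar mean value theorem is applied to the component of [F] along its own increment [h];
    dividing by |h| gives the bound. *)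
Lemma derive_bounded_lipschitz_inner (R : realType) (H : normedModType R)
    (inner : H -> H -> R) (F dF : R -> H) (a b K : R) :
  is_inner_product inner ->
  (forall t, a <= t -> t <= b -> is_derive t 1 F (dF t)) ->
  (forall t, a <= t -> t <= b -> `|dF t| <= K) ->
  forall u v, a <= u -> u <= v -> v <= b -> `|F v - F u| <= K * (v - u).
Proof.
move=> inn dFP dFK u v au uv vb.
set h := F v - F u.
have [->|h0] := eqVneq h 0.
  rewrite normr0 mulr_ge0 ?subr_ge0//.
  by apply: le_trans (dFK u au (le_trans uv vb)).
have := derive_bounded_lipschitz _ (fun t => inner (F t) h)
  (fun t => inner (dF t) h) a b (K * `|h|).
move=> /(_ _ _ u v au uv vb).
rewrite -(innerBl _ inn) (inner_norm _ inn) ger0_norm ?sqr_ge0// expr2.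
rewrite mulrAC ler_pM2r ?normr_gt0//; apply.
- move=> t at_ tb; have := is_derive_inner _ _ _ _ _ _ _ _ inn (dFP t at_ tb)
    (is_derive_cst h t 1).
  by rewrite [inner (F t) 0](innerC _ inn) (inner0l _ inn) addr0.
- move=> t at_ tb; apply: le_trans (norm_inner_le _ inn _ _) _.
  by apply: ler_wpM2r => //; exact: dFK.
Qed.

(* F is Lipschitz with respect to the increments of f and of time: such an F
   inherits absolute continuity from f. *)
Definition lip_along (R : realType) (H V : normedModType R) (f : R -> H)
  (a b : R) (F : R -> V) : Prop :=
  exists2 C, 0 <= C & (forall t, a <= t -> t <= b -> `|F t| <= C) /\
    forall u v, a <= u -> u <= v -> v <= b ->
      `|F v - F u| <= C * (`|f v - f u| + (v - u)).

Section LipAlong.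
Context {R : realType} {H : normedModType R} {f : R -> H} {a b : R}.
Local Notation lip := (lip_along _ _ _ f a b).

Lemma lip_lipschitz {V : normedModType R} (F : R -> V) (K : R) : a <= b -> 0 <= K ->
  (forall u v, a <= u -> u <= v -> v <= b -> `|F v - F u| <= K * (v - u)) ->
  lip F.
Proof.
(* In [lip_along] a single constant bounds both the values and the increments, hence this sum. *)
move=> ab K0 FK; exists (K + `|F a| + K * (b - a)).
  by rewrite !addr_ge0// mulr_ge0// subr_ge0.
split=> [t at_ tb|u v au uv vb].
  have := lerB_dist (F t) (F a); have := FK a t (lexx a) at_ tb.
  have : K * (t - a) <= K * (b - a) by rewrite ler_wpM2l// lerD2r.
  by lra.
apply: le_trans (FK u v au uv vb) _.
have := normr_ge0 (f v - f u); have : 0 <= v - u by lra.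
have := normr_ge0 (F a); have : 0 <= K * (b - a) by rewrite mulr_ge0// subr_ge0.
move: (K * (b - a)) `|F a| (v - u) `|f v - f u| => p q r s p0 q0 r0 s0.
have := mulr_ge0 (addr_ge0 p0 q0) (addr_ge0 r0 s0).
by have := mulr_ge0 K0 s0; lra.
Qed.

Lemma lip_self : a <= b -> (forall t, a <= t -> t <= b -> {for t, continuous f}) ->
  lip f.
Proof.
move=> ab cf; have [K K0 KP] := continuous_segment_bounded _ _ _ _ _ ab cf.
exists (K + 1); first by lra.
split=> [t at_ tb|u v au uv vb]; first by have := KP t at_ tb; lra.
have := normr_ge0 (f v - f u); nra.
Qed.

Lemma lip_cst (V : normedModType R) (k : V) : lip (fun=> k).
Proof.
exists `|k| => //; split=> // u v _ uv _; rewrite subrr normr0 mulr_ge0//.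
by rewrite addr_ge0// subr_ge0.
Qed.

Lemma lip_add (V : normedModType R) (F G : R -> V) :
  lip F -> lip G -> lip (fun t => F t + G t).
Proof.
move=> [C C0 [CF CP]] [D D0 [DG DP]]; exists (C + D); first exact: addr_ge0.
split=> [t at_ tb|u v au uv vb].
  by rewrite (le_trans (ler_normD _ _))// lerD//; [exact: CF|exact: DG].
rewrite opprD addrACA (le_trans (ler_normD _ _))// mulrDl lerD//.
  exact: CP.
exact: DP.
Qed.

Lemma lip_inner (inner : H -> H -> R) (F G : R -> H) : is_inner_product inner ->
  lip F -> lip G -> lip (fun t => inner (F t) (G t)).
Proof.
move=> inn [C C0 [CF CP]] [D D0 [DG DP]]; exists (2 * (C * D)).
  by rewrite !mulr_ge0.
split=> [t at_ tb|u v au uv vb].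
  apply: le_trans (norm_inner_le _ inn _ _) _.
  apply: (@le_trans _ _ (C * D)); last by have := mulr_ge0 C0 D0; lra.
  by apply: ler_pM => //; [exact: CF|exact: DG].
have -> : inner (F v) (G v) - inner (F u) (G u) =
          inner (F v - F u) (G v) + inner (F u) (G v - G u).
  by rewrite !(innerE _ inn); lra.
rewrite (le_trans (ler_normD _ _))//.
have ub := le_trans uv vb; have av := le_trans au uv.
have H1 := norm_inner_le _ inn (F v - F u) (G v).
have H2 := norm_inner_le _ inn (F u) (G v - G u).
have H3 : `|F v - F u| * `|G v| <= C * (`|f v - f u| + (v - u)) * D.
  by apply: ler_pM => //; [exact: CP|exact: DG].
have H4 : `|F u| * `|G v - G u| <= C * (D * (`|f v - f u| + (v - u))).
  by apply: ler_pM => //; [exact: CF|exact: DP].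
by lra.
Qed.

Lemma lip_mul (F G : R -> R) : lip F -> lip G -> lip (fun t => F t * G t).
Proof.
move=> [C C0 [CF CP]] [D D0 [DG DP]]; exists (2 * (C * D)).
  by rewrite !mulr_ge0.
split=> [t at_ tb|u v au uv vb].
  rewrite normrM; apply: (@le_trans _ _ (C * D)); last by have := mulr_ge0 C0 D0; lra.
  by apply: ler_pM => //; [exact: CF|exact: DG].
have -> : F v * G v - F u * G u = (F v - F u) * G v + F u * (G v - G u) by lra.
rewrite (le_trans (ler_normD _ _))// !normrM.
have ub := le_trans uv vb; have av := le_trans au uv.
have H3 : `|F v - F u| * `|G v| <= C * (`|f v - f u| + (v - u)) * D.
  by apply: ler_pM => //; [exact: CP|exact: DG].
have H4 : `|F u| * `|G v - G u| <= C * (D * (`|f v - f u| + (v - u))).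
  by apply: ler_pM => //; [exact: CF|exact: DP].
by lra.
Qed.

(* The control on D is one-sided, so that D may involve primitives known only
   to be monotone. *)
Lemma lip_nonincreasing (L D : R -> R) (K : R) :
  a <= b -> abs_cont_on f a b -> 0 <= K -> lip L ->
  (forall u v, a <= u -> u <= v -> v <= b -> D v - D u <= K * (v - u)) ->
  {ae (@lebesgue_measure R), forall t, a <= t -> t <= b ->
     exists2 d, d <= 0 & is_derive t 1 (fun s => L s + D s) d} ->
  L b + D b <= L a + D a.
Proof.
move=> ab fac K0 [C C0 [_ CP]] DK der.
apply: (ac_nonincreasing _ _ f (fun s => L s + D s) _ _ (C + K) ab) => //.
  exact: addr_ge0.
move=> u v au uv vb; have := CP u v au uv vb; rewrite ler_norml => /andP[_ LC].
have DC := DK u v au uv vb.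
have : 0 <= K * `|f v - f u| by exact: mulr_ge0.
by rewrite mulrDl !mulrDr in LC *; lra.
Qed.

End LipAlong.

(** * Scalar inequalities *)

Section ScalarInequalities.
Context {R : realType}.
Implicit Types a s c al : R.

(** Here [X], [Y], [p] and [phi] stand for |x|, |x'|, <x, x'> and Phi(x) - Phi(0). Young's
    inequality splits the cross term between half of the kinetic part and a fraction of c |x|^2; the
    assumption s/a <= c/32 makes that fraction small enough. *)
Lemma energy_coercive a s c al X Y p phi :
  0 <= al < 1 -> 0 < c -> 1 <= s -> s <= a -> 32 * s <= c * a ->
  0 <= X -> 0 <= Y -> `|p| <= X * Y -> 0 <= phi ->
  a * s * (Y ^+ 2 / 2 + phi) / 2 + c / 8 * X ^+ 2 <=
  a * s * (Y ^+ 2 / 2 + phi) + (1 + al) * s * p +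
    (1 + al) / 2 * (c - al * (s / a)) * X ^+ 2.
Proof.
move=> /andP[al0 al1] c0 s1 sa sc X0 Y0 pXY phi0.
have s0 : 0 < s by lra.
have a0 : 0 < a by lra.
have [r rE] : exists r, r = s / a by eexists.
have ra : s = r * a by rewrite rE divfK ?gt_eqF.
have r0 : 0 < r by rewrite rE divr_gt0.
have rc : 32 * r <= c.
  by rewrite -(ler_pM2r a0) -mulrA -ra.
rewrite -rE.
have H1 : - (2 * s * (X * Y)) <= (1 + al) * s * p.
  have : - (X * Y) <= p by move: pXY; rewrite ler_norml => /andP[].
  have XY0 := mulr_ge0 X0 Y0.
  move: (X * Y) XY0 => q q0 qp.
  have : (1 + al) * s * (- q) <= (1 + al) * s * p by rewrite ler_wpM2l// mulr_ge0; lra.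
  have : (1 - al) * (s * q) >= 0 by rewrite !mulr_ge0; lra.
  by lra.
have H2 : (31 / 64) * c * X ^+ 2 <= (1 + al) / 2 * (c - al * r) * X ^+ 2.
  have alr : al * r <= r by rewrite ler_piMl; lra.
  have alc : 0 <= al * (c - al * r) by rewrite mulr_ge0; lra.
  by rewrite ler_wpM2r ?sqr_ge0//; lra.
have H3 : 0 <= a * s * phi by rewrite !mulr_ge0// ltW.
have H4 : 8 * r * X ^+ 2 <= c / 4 * X ^+ 2.
  by rewrite ler_wpM2r ?sqr_ge0//; lra.
(* With s = r a this is Young's inequality 2 s X Y <= a s Y^2 / 4 + 8 r X^2. *)
have H5 : 0 <= r * ((a * Y / 2 - 2 * X) ^+ 2 + 4 * X ^+ 2).
  by rewrite mulr_ge0 ?addr_ge0 ?sqr_ge0 ?mulr_ge0 ?sqr_ge0//; lra.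
have H6 : 0 <= c * X ^+ 2 by rewrite mulr_ge0 ?sqr_ge0//; lra.
by rewrite ra in H1 H3 *; lra.
Qed.

Lemma le_geometric_mean a s w :
  0 <= s -> s <= a -> 0 < w -> w ^+ 2 = a * s -> s <= w.
Proof.
move=> s0 sa w0 ww; rewrite -(@ler_sqr R) ?nnegrE//; last exact: ltW.
by rewrite ww expr2 ler_wpM2r.
Qed.

Lemma lyap_coef_bounds al : 0 <= al -> al < 1 ->
  0 <= (1 + al) * al * (1 - al) / 2 <= 1.
Proof. by move=> al0 al1; apply/andP; split; nra. Qed.

Lemma le_1_sqr (y : R) : y <= 1 + y ^+ 2.
Proof. by have := sqr_ge0 (y - 1); nra. Qed.

(** The left-hand side is the derivative of [F], with [G], [gr], [gx], [gd] for |g|, <grad Phi(x),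
    x>, <x, g>, <x', g>. Half of the damping absorbs the terms in Y^2. The terms in [G] are linear
    in [X] or in w Y, and coercivity bounds both by 1 plus a multiple of [F]. *)
Lemma energy_derive_le a s w c al X Y G E p phi gr gx gd F :
  0 <= al < 1 -> 0 < c -> 1 <= s -> s <= a -> 32 * s <= c * a ->
  0 < w -> w ^+ 2 = a * s ->
  0 <= X -> 0 <= Y -> 0 <= G -> `|p| <= X * Y -> gx <= X * G -> gd <= Y * G ->
  0 <= phi -> phi <= gr -> E = Y ^+ 2 / 2 + phi ->
  F = a * s * E + (1 + al) * s * p + (1 + al) / 2 * (c - al * (s / a)) * X ^+ 2 ->
  (1 + al) * s * E + a * s * gd - c * a * Y ^+ 2 +
    (1 + al) * s * (Y ^+ 2 + gx - gr) +
    (1 + al) * al * (1 - al) / 2 * (s / a ^+ 2) * X ^+ 2 <=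
  - (c / 2 * a * Y ^+ 2) + (4 + 16 / c) * (w * G + s / a ^+ 2) * (1 + F).
Proof.
move=> alP c0 s1 sa sc w0 ww X0 Y0 G0 pXY gxX gdY phi0 phigr EE FE.
have := energy_coercive a s c al X Y p phi alP c0 s1 sa sc X0 Y0 pXY phi0.
rewrite -EE -FE => coer.
have /andP[al0 al1] := alP.
have s0 : 0 <= s by lra.
have a0 : 0 < a by lra.
have sw := le_geometric_mean a s w s0 sa w0 ww.
have cW := ltW c0; have aW := ltW a0; have wW := ltW w0.
have as0 : 0 <= a * s by exact: mulr_ge0.
have als : al * s <= s by rewrite ler_piMl// ltW.
have al1s : 0 <= (1 + al) * s by rewrite mulr_ge0// addr_ge0.
have E0 : Y ^+ 2 / 2 <= E by lra.
have asE : a * s * (Y ^+ 2 / 2) <= a * s * E by rewrite ler_wpM2l.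
have cX0 : 0 <= c * X ^+ 2 by rewrite mulr_ge0 ?sqr_ge0.
have asY0 : 0 <= a * s * Y ^+ 2 by rewrite mulr_ge0 ?sqr_ge0.
have F0 : 0 <= F by lra.
have Y4 : w * Y <= 1 + 4 * F.
  by apply: (le_trans (le_1_sqr _)); rewrite exprMn ww; lra.
have X8 : X ^+ 2 <= 8 / c * F.
  rewrite mulrAC ler_pdivlMr//; lra.
have X1 : X <= 1 + 8 / c * F by apply: (le_trans (le_1_sqr _)); lra.
(* Since phi <= gr, the potential part of [E] is cancelled and only 3/2 Y^2 remains; the factor 3 s
   is below c a / 2. *)
have T1 : (1 + al) * s * (E + Y ^+ 2 - gr) <= c / 2 * a * Y ^+ 2.
  have : (1 + al) * s * (E + Y ^+ 2 - gr) <= (1 + al) * s * (3 / 2 * Y ^+ 2).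
    by rewrite ler_wpM2l//; lra.
  have : (1 + al) * s * (3 / 2 * Y ^+ 2) <= c / 2 * a * Y ^+ 2.
    by rewrite mulrA ler_wpM2r ?sqr_ge0//; lra.
  by lra.
have wG0 : 0 <= w * G by rewrite mulr_ge0.
have T2 : a * s * gd <= w * G * (1 + 4 * F).
  apply: (@le_trans _ _ (w * G * (w * Y))); last by rewrite ler_wpM2l.
  have -> : w * G * (w * Y) = a * s * (Y * G) by rewrite -ww; ring.
  by rewrite ler_wpM2l.
have T3 : (1 + al) * s * gx <= 2 * (w * G) * (1 + 8 / c * F).
  apply: (@le_trans _ _ (2 * (w * G) * X)); last by rewrite ler_wpM2l// mulr_ge0.
  apply: (@le_trans _ _ ((1 + al) * s * (X * G))).
    by rewrite ler_wpM2l.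
  have -> : 2 * (w * G) * X = 2 * w * (X * G) by ring.
  by rewrite ler_wpM2r ?mulr_ge0//; lra.
have sa0 : 0 <= s / a ^+ 2 by rewrite divr_ge0 ?sqr_ge0.
have /andP[kal0 kal1] := lyap_coef_bounds al al0 al1.
have T4 : (1 + al) * al * (1 - al) / 2 * (s / a ^+ 2) * X ^+ 2 <=
    (s / a ^+ 2) * (8 / c * F).
  apply: ler_pM; [|exact: sqr_ge0| |exact: X8].
    by rewrite mulr_ge0.
  by rewrite ler_piMl.
have -> : 16 / c = 2 * (8 / c) by ring.
have k0 : 0 <= 8 / c by rewrite divr_ge0.
move: (8 / c) k0 X8 X1 T3 T4 => k k0 X8 X1 T3 T4.
have Q1 : 0 <= w * G * k by rewrite mulr_ge0.
have Q2 : 0 <= w * G * F by rewrite mulr_ge0.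
have Q3 : 0 <= (s / a ^+ 2) * (4 + 2 * k) by rewrite mulr_ge0//; lra.
have Q4 : 0 <= s / a ^+ 2 * F * (4 + k) by rewrite mulr_ge0 ?(mulr_ge0 sa0 F0)//; lra.
move: (s / a ^+ 2) sa0 T4 Q3 Q4 => q q0 T4 Q3 Q4.
by lra.
Qed.

(** Here [p], [q] are the products of x and x T with x', [gr], [grT] their products with the
    gradient, and [D] is J T - J t. [A] makes the damping in [Fd] yield (2 M + 2) a Y^2, enough for
    all kinetic terms. In [C2], the part 2 M pays for the cross and forcing terms and [b] for the
    last summand. *)
Lemma anchored_derive_le a s w c al M b C1 A C2 Fd Y G D p q gx gxT gr grT :
  0 <= al < 1 -> 0 < c -> 1 <= s -> s <= a -> 0 < w -> w ^+ 2 = a * s ->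
  0 <= M -> 0 <= b -> 0 <= Y -> 0 <= G -> 0 <= D ->
  Fd <= - (c / 2 * a * Y ^+ 2) + C1 * (w * G + s / a ^+ 2) ->
  p <= M * Y -> q <= M * Y -> gx <= M * G -> gxT <= M * G ->
  - (gr + grT) <= Y ^+ 2 / 2 + b * D ->
  A = 2 / c * (2 * M + 2) -> C2 = 2 * M + b ->
  al * (s / a) * (p + q) + s * (Y ^+ 2 + (gx + gxT) - (gr + grT)) +
    A * (Fd - C1 * (w * G + s / a ^+ 2)) - C2 * (w * G + s / a ^+ 2) -
    b * ((1 + al) * s * D) + b * (w * G) <= 0.
Proof.
move=> alP c0 s1 sa w0 ww M0 b0 Y0 G0 D0 FdP pM qM gxM gxTM gP AE C2E.
have /andP[al0 al1] := alP.
have s0 : 0 <= s by lra.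
have a0 : 0 < a by lra.
have sw := le_geometric_mean a s w s0 sa w0 ww.
have aW := ltW a0.
have A0 : 0 <= A.
  by rewrite AE mulr_ge0 ?divr_ge0 ?(ltW c0)// addr_ge0// mulr_ge0.
have H1 : A * (Fd - C1 * (w * G + s / a ^+ 2)) <= - ((2 * M + 2) * (a * Y ^+ 2)).
  have -> : - ((2 * M + 2) * (a * Y ^+ 2)) = A * - (c / 2 * a * Y ^+ 2).
    by rewrite AE; field; rewrite gt_eqF.
  by rewrite ler_wpM2l//; lra.
have [r rE] : exists r, r = s / a by eexists.
have ra : s = r * a by rewrite rE divfK ?gt_eqF.
have r0 : 0 <= r by rewrite rE divr_ge0.
have r1 : r <= 1 by rewrite rE ler_pdivrMr// mul1r.
have [i iE] : exists i, i = r / a by eexists.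
have ia : r = i * a by rewrite iE divfK ?gt_eqF.
have i0 : 0 <= i by rewrite iE divr_ge0.
have iE' : s / a ^+ 2 = i by rewrite iE rE; field; rewrite gt_eqF.
have H2 : al * r * (p + q) <= 2 * M * (a * Y ^+ 2 + i).
  have e1 : al * r * (p + q) <= al * r * (2 * M * Y).
    by rewrite ler_wpM2l ?mulr_ge0//; lra.
  have e2 : al * (r * (2 * M * Y)) <= r * (2 * M * Y).
    by rewrite ler_piMl ?(ltW al1)// !mulr_ge0.
  have e3 : r * Y <= a * Y ^+ 2 + i.
    (* With r = i a this reads r Y <= a Y^2 + r i, and r i <= i because r <= 1. *)
    have : 0 <= a * ((Y - i / 2) ^+ 2 + 3 / 4 * i ^+ 2).
      by rewrite mulr_ge0// addr_ge0 ?sqr_ge0// mulr_ge0 ?sqr_ge0.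
    have : 0 <= i * (1 - r) by rewrite mulr_ge0//; lra.
    by rewrite ia; lra.
  have e4 : 2 * M * (r * Y) <= 2 * M * (a * Y ^+ 2 + i).
    by rewrite ler_wpM2l// mulr_ge0.
  by lra.
have H3 : s * (Y ^+ 2 + (gx + gxT) - (gr + grT)) <=
    3 / 2 * (a * Y ^+ 2) + 2 * M * (w * G) + b * (s * D).
  have e1 : s * (Y ^+ 2 + (gx + gxT) - (gr + grT)) <=
      s * (3 / 2 * Y ^+ 2 + 2 * M * G + b * D) by rewrite ler_wpM2l//; lra.
  have e2 : s * Y ^+ 2 <= a * Y ^+ 2 by rewrite ler_wpM2r ?sqr_ge0.
  have e3 : s * (2 * M * G) <= w * (2 * M * G) by rewrite ler_wpM2r ?mulr_ge0.
  by lra.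
have H4 : 0 <= b * (al * (s * D)) by rewrite !mulr_ge0.
have H5 : 0 <= b * i by rewrite mulr_ge0.
have H6 : 0 <= a * Y ^+ 2 by rewrite mulr_ge0 ?sqr_ge0.
rewrite -rE iE' C2E in H1 *.
by lra.
Qed.

End ScalarInequalities.

(** * Lyapunov analysis *)

Section PointwiseDerive.
Context {R : realType} (t : R).
Implicit Types (f g : R -> R) (df dg : R).

Lemma eq_is_derive f g df : f =1 g -> is_derive t 1 f df -> is_derive t 1 g df.
Proof. by move=> /funext ->. Qed.

Lemma is_derive_add f g df dg : is_derive t 1 f df -> is_derive t 1 g dg ->
  is_derive t 1 (fun s => f s + g s) (df + dg).
Proof. exact: is_deriveD. Qed.

Lemma is_derive_mul f g df dg : is_derive t 1 f df -> is_derive t 1 g dg ->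
  is_derive t 1 (fun s => f s * g s) (df * g t + f t * dg).
Proof.
move=> fd gd; rewrite [df * _]mulrC addrC.
exact: (@is_deriveM _ _ f g t 1 df dg fd gd).
Qed.

Lemma is_derive_mulcl k f df : is_derive t 1 f df ->
  is_derive t 1 (fun s => k * f s) (k * df).
Proof. by move=> fd; exact: (is_deriveZ k fd). Qed.

Lemma is_derive_ln1 f df : 0 <= f t -> is_derive t 1 f df ->
  is_derive t 1 (fun s => ln (1 + f s)) (df / (1 + f t)).
Proof.
move=> f0 fd; have ft : 0 < 1 + f t by lra.
have fd1 : is_derive t 1 (fun s => 1 + f s) df.
  rewrite -[df]add0r; apply: is_derive_add fd; exact: is_derive_cst.
have := @is_derive1_comp R (@ln R) (fun s => 1 + f s) t _ _ (is_derive1_ln ft) fd1.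
by rewrite mulrC.
Qed.

Lemma is_derive_1p : is_derive t 1 (fun s => 1 + s) 1.
Proof.
by rewrite -[X in is_derive _ _ _ X]add0r; apply: is_derive_add.
Qed.

Lemma is_derive_div1p f df : 0 < t -> is_derive t 1 f df ->
  is_derive t 1 (fun s => f s / (1 + s)) (df / (1 + t) - f t / (1 + t) ^+ 2).
Proof.
move=> t0 fd.
have id1 : is_derive t 1 (fun s => (1 + s)^-1) (- (1 + t)^-2).
  have a0 : 1 + t != 0 by rewrite gt_eqF; lra.
  have := @is_deriveV _ (fun s => 1 + s) t 1 1 a0 is_derive_1p.
  by rewrite [_ *: _]mulr1.
by have := is_derive_mul _ _ _ _ fd id1; rewrite mulrN.
Qed.

End PointwiseDerive.

(** * The trajectory and its Lyapunov functional *)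

Section Dynamics.
Context {R : realType} {H : normedModType R}.
(** [sg] and [w] stand for the powers alpha and (1 + alpha) / 2 of 1 + t, so that c / sg t is the
    damping gamma(t). They and the primitives [W], [J] enter through the properties assumed here. *)
Variables (inner : H -> H -> R) (Phi : H -> R) (gradPhi : H -> H)
  (c alpha : R) (g x xd : R -> H) (sg w W J : R -> R) (K : R).
Hypothesis inn : is_inner_product inner.
Hypothesis cPhi : convex_fun Phi.
Hypothesis Phi1 : C1_with_gradient inner Phi gradPhi.
Hypothesis evenPhi : forall y, Phi (- y) = Phi y.
Hypothesis c0 : 0 < c.
Hypothesis alphaP : 0 <= alpha < 1.
Hypothesis dx : forall t : R, 0 < t -> is_derive t 1 x (xd t).
Hypothesis xdac : loc_abs_cont_pos xd.
Hypothesis sg1 : forall t : R, 0 < t -> 1 <= sg t.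
Hypothesis sg_le : forall t : R, 0 < t -> sg t <= 1 + t.
Hypothesis dsg : forall t : R, 0 < t -> is_derive t 1 sg (alpha * (sg t / (1 + t))).
Hypothesis w0 : forall t : R, 0 < t -> 0 < w t.
Hypothesis w2 : forall t : R, 0 < t -> w t ^+ 2 = (1 + t) * sg t.
Hypothesis sg_small : forall e : R, 0 < e ->
  exists T, forall t : R, 0 < t -> T <= t -> sg t <= e * (1 + t).
Hypothesis Wmon : forall u v : R, u <= v -> W u <= W v.
Hypothesis Jmon : forall u v : R, u <= v -> J u <= J v.
Hypothesis WJK : forall t, [/\ 0 <= W t, W t <= K, 0 <= J t & J t <= K].
Hypothesis WJ : forall u v : R, 0 < u -> u <= v ->
  w u ^+ 2 * (J v - J u) <= W v - W u.

Definition good (t : R) := exists xdd, [/\ is_derive t 1 xd xdd,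
  xdd = g t - (c / sg t) *: xd t - gradPhi (x t),
  is_derive t 1 W (w t * `|g t|) & is_derive t 1 J (`|g t| / w t)].

Hypothesis ode : {ae (@lebesgue_measure R), forall t : R, 0 < t -> good t}.

(** The point 0 is the midpoint of [y] and [- y], where [Phi] takes the same value. *)
Lemma Phi0_min y : Phi 0 <= Phi y.
Proof.
have := cPhi y (- y) (1 / 2); rewrite evenPhi.
have -> : (1 / 2 : R) *: y + (1 - 1 / 2) *: - y = 0.
  by rewrite scalerN -scalerBl (_ : 1 / 2 - (1 - 1 / 2) = 0) ?scale0r//; lra.
have -> : 0 <= (1 / 2 : R) <= 1 by apply/andP; split; lra.
by move=> /(_ isT); lra.
Qed.

Definition energy (t : R) := inner (xd t) (xd t) / 2 + (Phi (x t) - Phi 0).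

(* The weights 1 + alpha and (c - alpha s/a) make the <x, x'> terms cancel in
   the derivative. *)
Definition lyap (t : R) := (1 + t) * sg t * energy t +
  (1 + alpha) * (sg t * inner (x t) (xd t)) +
  (1 + alpha) / 2 * ((c - alpha * (sg t / (1 + t))) * inner (x t) (x t)).

Lemma good_inner (t : R) : 0 < t -> good t ->
  exists2 xdd, is_derive t 1 xd xdd & forall y, inner y xdd =
    inner y (g t) - c / sg t * inner y (xd t) - inner (gradPhi (x t)) y.
Proof.
move=> t0 [xdd [d1 xddE _ _]]; exists xdd => // z.
by rewrite xddE !(innerE _ inn) (innerC _ inn z (gradPhi _)).
Qed.

Lemma derive_energy (t : R) : 0 < t -> good t ->
  is_derive t 1 energy
    (inner (xd t) (g t) - c / sg t * inner (xd t) (xd t)).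
Proof.
move=> t0 gt; have [xdd dxd xddE] := good_inner t t0 gt.
have := is_derive_add _ _ _ _ _
  (is_derive_mulcl _ (2^-1) _ _ (is_derive_inner _ _ _ _ _ _ _ _ inn dxd dxd))
  (is_derive_add _ _ _ _ _ (is_derive_gradient_comp Phi1 _ _ _ (dx t t0))
    (is_derive_cst (- Phi 0) t 1)).
rewrite (innerC _ inn xdd) xddE => D; rewrite /energy.
have -> : (fun t => inner (xd t) (xd t) / 2 + (Phi (x t) - Phi 0)) =
  (fun s => 2^-1 * inner (xd s) (xd s) + (Phi (x s) + cst (- Phi 0) s)).
  by apply/funext => s /=; rewrite mulrC.
by apply: is_derive_eq D _; lra.
Qed.

Definition lyap_d (t : R) := (1 + alpha) * sg t * energy t +
    (1 + t) * sg t * inner (xd t) (g t) - c * (1 + t) * `|xd t| ^+ 2 +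
    (1 + alpha) * sg t * (`|xd t| ^+ 2 + inner (x t) (g t) -
       inner (gradPhi (x t)) (x t)) +
    (1 + alpha) * alpha * (1 - alpha) / 2 * (sg t / (1 + t) ^+ 2) * `|x t| ^+ 2.

Lemma derive_lyap (t : R) : 0 < t -> good t -> is_derive t 1 lyap (lyap_d t).
Proof.
move=> t0 gt; have [xdd dxd xddE] := good_inner t t0 gt.
have dE := derive_energy t t0 gt.
have ds := dsg t t0.
have dxx := is_derive_inner _ _ _ _ _ _ _ _ inn (dx t t0) (dx t t0).
have dxxd := is_derive_inner _ _ _ _ _ _ _ _ inn (dx t t0) dxd.
have dr := is_derive_mulcl _ (- alpha) _ _ (is_derive_div1p _ _ _ t0 ds).
have dcr := is_derive_add _ _ _ _ _ (is_derive_cst c t 1) dr.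
have D := is_derive_add _ _ _ _ _ (is_derive_add _ _ _ _ _
  (is_derive_mul _ _ _ _ _ (is_derive_mul _ _ _ _ _ (is_derive_1p t) ds) dE)
  (is_derive_mulcl _ (1 + alpha) _ _ (is_derive_mul _ _ _ _ _ ds dxxd)))
  (is_derive_mulcl _ ((1 + alpha) / 2) _ _ (is_derive_mul _ _ _ _ _ dcr dxx)).
have -> : lyap = (fun s => (1 + s) * sg s * energy s +
   (1 + alpha) * (sg s * inner (x s) (xd s)) +
   (1 + alpha) / 2 * ((cst c s + - alpha * (sg s / (1 + s))) * inner (x s) (x s))).
  by apply/funext => s; rewrite /lyap /= mulNr.
apply: is_derive_eq D _.
rewrite xddE (innerC _ inn (xd t) (x t)) /lyap_d /=.
rewrite -!(inner_norm _ inn).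
have a0 : 1 + t != 0 by rewrite gt_eqF; lra.
have s0 : sg t != 0 by rewrite gt_eqF//; have := sg1 t t0; lra.
by field; rewrite a0 s0.
Qed.

Lemma Phi_le_grad (t : R) : Phi (x t) - Phi 0 <= inner (gradPhi (x t)) (x t).
Proof.
have := convex_gradient_le Phi1 cPhi (x t) 0.
by rewrite sub0r (innerNr _ inn); lra.
Qed.

Lemma lyap_d_le (t : R) : 0 < t -> 32 * sg t <= c * (1 + t) ->
  lyap_d t <= - (c / 2 * (1 + t) * `|xd t| ^+ 2) +
   (4 + 16 / c) * (w t * `|g t| + sg t / (1 + t) ^+ 2) * (1 + lyap t).
Proof.
move=> t0 sc.
apply: (@energy_derive_le R _ _ _ _ _ _ _ _ _ (inner (x t) (xd t))
  (Phi (x t) - Phi 0)) => //.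
- exact: sg1.
- exact: sg_le.
- exact: w0.
- exact: w2.
- exact: norm_inner_le.
- exact: inner_le_norm.
- exact: inner_le_norm.
- by rewrite subr_ge0 Phi0_min.
- exact: Phi_le_grad.
- by rewrite /energy (inner_norm _ inn).
- by rewrite /lyap (inner_norm _ inn); ring.
Qed.

Lemma lyap_coercive (t : R) : 0 < t -> 32 * sg t <= c * (1 + t) ->
  (1 + t) * sg t * energy t / 2 + c / 8 * `|x t| ^+ 2 <= lyap t.
Proof.
move=> t0 sc; rewrite /lyap /energy !(inner_norm _ inn).
have := energy_coercive (1 + t) (sg t) c alpha `|x t| `|xd t|
  (inner (x t) (xd t)) (Phi (x t) - Phi 0).
move=> /(_ alphaP c0 (sg1 t t0) (sg_le t t0) sc).
move=> /(_ (normr_ge0 _) (normr_ge0 _) (norm_inner_le _ inn _ _)).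
rewrite subr_ge0 Phi0_min => /(_ isT) /le_trans; apply.
by rewrite le_eqVlt; apply/orP; left; apply/eqP; ring.
Qed.


Lemma sg_ratio_le1 (t : R) : 0 < t -> 0 <= sg t / (1 + t) <= 1.
Proof.
move=> t0; have a0 : 0 < 1 + t by lra.
have := sg1 t t0; have := sg_le t t0 => sl s1.
by rewrite divr_ge0 ?ler_pdivrMr ?mul1r//=; lra.
Qed.

Lemma derive_sg_ratio (t : R) : 0 < t ->
  is_derive t 1 (fun s => sg s / (1 + s)) (- (1 - alpha) * (sg t / (1 + t) ^+ 2)).
Proof.
move=> t0; apply: is_derive_eq (is_derive_div1p _ _ _ t0 (dsg t t0)) _.
by field; rewrite gt_eqF//; lra.
Qed.

(** * Regularity of the functionals on compact time intervals *)

Section Lip.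
Variables a b : R.
Hypotheses (a0 : 0 < a) (ab : a <= b).
Local Notation lip := (lip_along _ _ _ xd a b).

Lemma lip_sg : lip sg.
Proof.
apply: (lip_lipschitz _ 1) => //; apply: (derive_bounded_lipschitz _ _ _ _ _ _
  (fun t at_ tb => dsg t (lt_le_trans a0 at_))).
move=> t at_ tb; have /andP[r0 r1] := sg_ratio_le1 t (lt_le_trans a0 at_).
have /andP[al0 al1] := alphaP.
rewrite /= ger0_norm; last exact: mulr_ge0.
by rewrite mulr_ile1//; lra.
Qed.

Lemma lip_1p : lip (fun s => 1 + s).
Proof.
apply: (lip_lipschitz _ 1) => // u v au uv vb.
by rewrite (_ : 1 + v - (1 + u) = v - u) ?ger0_norm ?mul1r ?subr_ge0//; lra.
Qed.

Lemma lip_sg_ratio : lip (fun s => sg s / (1 + s)).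
Proof.
apply: (lip_lipschitz _ 1) => //; apply: (derive_bounded_lipschitz _ _ _ _ _ _
  (fun t at_ tb => derive_sg_ratio t (lt_le_trans a0 at_))).
move=> t at_ tb; have t0 := lt_le_trans a0 at_.
have /andP[r0 r1] := sg_ratio_le1 t t0.
have /andP[al0 al1] := alphaP.
have i0 : 0 <= (1 + t)^-1 by rewrite invr_ge0; lra.
have i1 : (1 + t)^-1 <= 1 by rewrite invf_le1; lra.
rewrite /= (_ : _ * _ = - ((1 - alpha) * (sg t / (1 + t) * (1 + t)^-1))); last first.
  by field; rewrite gt_eqF//; lra.
have q0 : 0 <= sg t / (1 + t) * (1 + t)^-1 by exact: mulr_ge0.
have q1 : sg t / (1 + t) * (1 + t)^-1 <= 1 by exact: mulr_ile1.
by rewrite normrN ger0_norm; [rewrite mulr_ile1//; lra|rewrite mulr_ge0//; lra].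
Qed.

Lemma continuous_xd (t : R) : a <= t -> t <= b -> {for t, continuous xd}.
Proof. by move=> at_ tb; apply: ac_continuous => //; exact: lt_le_trans at_. Qed.

Lemma lip_xd : lip xd.
Proof. exact: lip_self continuous_xd. Qed.

Lemma lip_x : lip x.
Proof.
have [M M0 MP] := continuous_segment_bounded _ _ _ _ _ ab continuous_xd.
apply: (lip_lipschitz _ M) => //; apply: (derive_bounded_lipschitz_inner _ _ _ _ _ _ _ _
  inn (fun t at_ tb => dx t (lt_le_trans a0 at_))).
exact: MP.
Qed.

Lemma lip_Phi_x : lip (fun s => Phi (x s)).
Proof.
have [M M0 MP] := continuous_segment_bounded _ _ _ _ _ ab continuous_xd.
have cg t : a <= t -> t <= b -> {for t, continuous (fun s => gradPhi (x s))}.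
  move=> at_ tb; apply: continuous_comp; last exact: Phi1.2.
  exact: is_derive_continuous (dx t (lt_le_trans a0 at_)).
have [N N0 NP] := continuous_segment_bounded _ _ _ _ _ ab cg.
apply: (lip_lipschitz _ (N * M)) => //; first exact: mulr_ge0.
apply: (derive_bounded_lipschitz _ _ _ _ _ _
  (fun t at_ tb => is_derive_gradient_comp Phi1 _ _ _ (dx t (lt_le_trans a0 at_)))).
move=> t at_ tb; apply: le_trans (norm_inner_le _ inn _ _) _.
by apply: ler_pM => //; [exact: NP|exact: MP].
Qed.

Lemma lip_mulcl k (F : R -> R) : lip F -> lip (fun s => k * F s).
Proof. by move=> FL; apply: lip_mul => //; exact: lip_cst. Qed.

Lemma lip_energy : lip energy.
Proof.
apply: lip_add; first by apply: lip_mul (lip_cst _ _); apply: lip_inner lip_xd lip_xd.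
by apply: lip_add lip_Phi_x (lip_cst _ _).
Qed.

Lemma lip_lyap : lip lyap.
Proof.
apply: lip_add; first apply: lip_add.
- by apply: lip_mul lip_energy; exact: lip_mul lip_1p lip_sg.
- by apply: lip_mulcl; apply: lip_mul lip_sg _; apply: lip_inner lip_x lip_xd.
- apply: lip_mulcl; apply: lip_mul; last by apply: lip_inner lip_x lip_x.
  apply: lip_add; first exact: lip_cst.
  have -> : (fun t => - (alpha * (sg t / (1 + t)))) =
            (fun t => - alpha * (sg t / (1 + t))).
    by apply/funext => t; rewrite mulNr.
  exact: lip_mulcl lip_sg_ratio.
Qed.

(** On nonnegative arguments ln(1 + z) is 1-Lipschitz and at most z, so the constant of [F] is
    inherited. *)
Lemma lip_ln1 (F : R -> R) : (forall t, a <= t -> t <= b -> 0 <= F t) ->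
  lip F -> lip (fun s => ln (1 + F s)).
Proof.
move=> F0 [C C0 [CF CP]]; exists C => //; split=> [t at_ tb|u v au uv vb].
  have Ft := F0 t at_ tb.
  rewrite ger0_norm; last by rewrite ln_ge0; lra.
  apply: le_trans (CF t at_ tb); rewrite ger0_norm//.
  by apply: le_ln1Dx; lra.
have av := le_trans au uv; have ub := le_trans uv vb.
apply: le_trans (CP u v au uv vb).
have key p q : 0 <= p -> 0 <= q -> ln (1 + p) - ln (1 + q) <= `|p - q|.
  move=> p0 q0; rewrite -ln_div ?posrE; [|lra|lra].
  have -> : (1 + p) / (1 + q) = 1 + (p - q) / (1 + q).
    by field; rewrite gt_eqF//; lra.
  apply: (@le_trans _ _ ((p - q) / (1 + q))).
    by apply: le_ln1Dx; rewrite ltr_pdivlMr; lra.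
  apply: le_trans (ler_norm _) _; rewrite normrM ler_piMr//.
  rewrite ger0_norm ?invr_ge0 ?invf_le1; lra.
by rewrite ler_norml lerNl opprB {1}distrC !key ?F0.
Qed.

End Lip.

(** Gronwall's argument in logarithmic form: the derivative of ln(1 + lyap) is at most C0 (W' +
    s/a^2), and both terms have bounded primitives. *)
Lemma lyap_bounded : exists t1 B : R, [/\ 0 < t1, 0 <= B &
  forall t, t1 <= t -> 32 * sg t <= c * (1 + t) /\ lyap t <= B].
Proof.
have /andP[al0 al1] := alphaP.
have cgt0 : 0 < c := c0.
have [|T TP] := sg_small (c / 32); first by rewrite divr_gt0.
pose t1 := Num.max 1 T.
have t10 : 0 < t1 by rewrite lt_max ltr01.
have big t : t1 <= t -> 0 < t /\ 32 * sg t <= c * (1 + t).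
  rewrite ge_max => /andP[t1' Tt]; have t0 : 0 < t by lra.
  by split => //; have := TP t t0 Tt; lra.
have lyap0 t : t1 <= t -> 0 <= lyap t.
  move=> /big[t0 sc]; apply: le_trans (lyap_coercive t t0 sc).
  have e0 : 0 <= energy t.
    by rewrite /energy (inner_norm _ inn); have := Phi0_min (x t);
      have := sqr_ge0 `|xd t|; lra.
  have s1 := sg1 t t0; apply: addr_ge0.
    by rewrite divr_ge0// mulr_ge0// mulr_ge0//; lra.
  by rewrite mulr_ge0 ?sqr_ge0// divr_ge0// ltW.
pose C0 := 4 + 16 / c.
have C00 : 0 <= C0 by rewrite addr_ge0// divr_ge0//; lra.
(* The added term is decreasing with derivative - C0 s/a^2, since (s/a)' = - (1 - alpha) s/a^2. *)
pose L (t : R) := ln (1 + lyap t) + C0 / (1 - alpha) * (sg t / (1 + t)).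
have mono t : t1 <= t -> L t - C0 * W t <= L t1 - C0 * W t1.
  move=> tt; apply: (@lip_nonincreasing R H xd t1 t L (fun s => - (C0 * W s)) 0) => //.
  - exact: xdac.
  - apply: lip_add.
      apply: lip_ln1; last exact: lip_lyap.
      by move=> s ts _; exact: lyap0.
    by apply: lip_mulcl; exact: lip_sg_ratio.
  - by move=> u v _ uv _; rewrite mul0r;
      have := ler_wpM2l C00 (Wmon _ _ uv); lra.
  - apply: ae_impl ode _ => s gs ts st.
    have [s0 sc] := big s ts; have {}gs := gs s0.
    have [_ [_ _ dW _]] := gs.
    have D := is_derive_add _ _ _ _ _ (is_derive_add _ _ _ _ _
      (is_derive_ln1 _ _ _ (lyap0 s ts) (derive_lyap s s0 gs))
      (is_derive_mulcl _ (C0 / (1 - alpha)) _ _ (derive_sg_ratio s s0)))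
      (is_derive_mulcl _ (- C0) _ _ dW).
    eexists; last first.
      rewrite (_ : (fun s => L s - C0 * W s) = (fun s => L s + - C0 * W s)).
        exact: D.
      by apply/funext => r; rewrite mulNr.
    have := lyap_d_le s s0 sc; rewrite -/C0 => dle.
    have F0 := lyap0 s ts; have F1 : 0 < 1 + lyap s by lra.
    have : lyap_d s / (1 + lyap s) <= C0 * (w s * `|g s| + sg s / (1 + s) ^+ 2).
      rewrite ler_pdivrMr//; apply: le_trans dle _; rewrite gerDr oppr_le0.
      by rewrite !mulr_ge0 ?sqr_ge0//; lra.
    have -> : C0 / (1 - alpha) * (- (1 - alpha) * (sg s / (1 + s) ^+ 2)) =
      - C0 * (sg s / (1 + s) ^+ 2).
      by field; rewrite !gt_eqF//; lra.
    by lra.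
pose Q := L t1 - C0 * W t1 + C0 * K.
exists t1, (expR Q); split; [exact: t10|exact: expR_ge0|].
move=> t tt; have [t0 sc] := big t tt; split => //.
have F0 := lyap0 t tt.
apply: (@le_trans _ _ (1 + lyap t)); first by lra.
rewrite -[leLHS]lnK ?posrE; last by lra.
rewrite ler_expR /Q; have := mono t tt; rewrite {1}/L.
have [_ WK _ _] := WJK t; have := ler_wpM2l C00 WK.
have /andP[r0 _] := sg_ratio_le1 t t0.
have : 0 <= C0 / (1 - alpha) * (sg t / (1 + t)).
  by rewrite mulr_ge0// divr_ge0//; lra.
by lra.
Qed.

(** * Estimates for large times *)

Section Late.
Variables t1 B : R.
Hypotheses (t1_gt0 : 0 < t1) (B_ge0 : 0 <= B).
Hypothesis late : forall t, t1 <= t ->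
  32 * sg t <= c * (1 + t) /\ lyap t <= B.

(** [M] bounds |x| and [b] bounds w |x'|, both by y <= 1 + y^2 and coercivity. [C1] is the constant
    of [lyap_d_le] once lyap <= B; [A] and [C2] are those of [anchored_derive_le]. *)
Let M := 1 + 8 / c * B.
Let b := 1 + 4 * B.
Let C1 := (4 + 16 / c) * (1 + B).
Let A := 2 / c * (2 * M + 2).
Let C2 := 2 * M + b.

Lemma late_consts : [/\ 0 <= M, 0 <= b, 0 <= C1, 0 <= A & 0 <= C2].
Proof.
have cgt0 : 0 < c := c0; have B0 : 0 <= B := B_ge0.
have k0 : 0 <= 8 / c by rewrite divr_ge0// ltW.
have k1 : 0 <= 16 / c by rewrite divr_ge0// ltW.
have k2 : 0 <= 2 / c by rewrite divr_ge0// ltW.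
have M0 : 0 <= M by rewrite /M addr_ge0// mulr_ge0.
have b0 : 0 <= b by rewrite /b; lra.
split=> //.
- by rewrite /C1 mulr_ge0//; lra.
- by rewrite /A mulr_ge0//; lra.
- by rewrite /C2; lra.
Qed.

Lemma late_gt0 (t : R) : t1 <= t -> 0 < t. Proof. exact: lt_le_trans. Qed.

Lemma energy_ge (t : R) : `|xd t| ^+ 2 / 2 <= energy t.
Proof. by rewrite /energy (inner_norm _ inn) lerDl subr_ge0 Phi0_min. Qed.

Lemma sg_energy_ge0 (t : R) : 0 < t -> 0 <= (1 + t) * sg t * energy t.
Proof.
move=> t0; have s1 := sg1 t t0.
have := energy_ge t; have := sqr_ge0 `|xd t| => y0 ye.
by rewrite !mulr_ge0//; lra.
Qed.

Lemma late_energy (t : R) : t1 <= t -> (1 + t) * sg t * energy t <= 2 * B.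
Proof.
move=> tt; have [sc FB] := late t tt; have t0 := late_gt0 t tt.
have := lyap_coercive t t0 sc.
have : 0 <= c / 8 * `|x t| ^+ 2 by rewrite mulr_ge0 ?sqr_ge0// divr_ge0// ltW.
by lra.
Qed.

Lemma late_x (t : R) : t1 <= t -> `|x t| <= M.
Proof.
move=> tt; have [sc FB] := late t tt; have t0 := late_gt0 t tt.
have := lyap_coercive t t0 sc; have := sg_energy_ge0 t t0 => E0 FE.
have cX : `|x t| ^+ 2 * c <= 8 * B by lra.
apply: le_trans (le_1_sqr _) _.
by rewrite lerD2l mulrAC ler_pdivlMr.
Qed.

Lemma late_xd (t : R) : t1 <= t -> w t * `|xd t| <= b.
Proof.
move=> tt; have t0 := late_gt0 t tt.
apply: le_trans (le_1_sqr _) _; rewrite exprMn w2//.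
have := late_energy t tt; have e1 := energy_ge t.
have s1 := sg1 t t0.
have : (1 + t) * sg t * (`|xd t| ^+ 2 / 2) <= (1 + t) * sg t * energy t.
  by rewrite ler_wpM2l// mulr_ge0//; lra.
by rewrite /b; lra.
Qed.

(** Damping only lowers the energy, and the forcing contributes at most |x'| |g| = (w |x'|) (|g| /
    w) <= b J'. *)
Lemma energy_increment (t T : R) : t1 <= t -> t <= T ->
  energy T - energy t <= b * (J T - J t).
Proof.
move=> tt tT; have t0 := late_gt0 t tt.
have [_ b0 _ _ _] := late_consts.
suff : energy T + - (b * J T) <= energy t + - (b * J t) by lra.
apply: (@lip_nonincreasing R H xd t T energy (fun s => - (b * J s)) 0) => //.
- exact: xdac.
- exact: lip_energy.
- by move=> u v _ uv _; rewrite mul0r; have := ler_wpM2l b0 (Jmon _ _ uv); lra.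
- apply: ae_impl ode _ => s gs ts sT.
  have ss : t1 <= s by exact: le_trans ts.
  have s0 := late_gt0 s ss; have {}gs := gs s0.
  have [_ [_ _ _ dJ]] := gs.
  have D := is_derive_add _ _ _ _ _ (derive_energy s s0 gs)
    (is_derive_mulcl _ (- b) _ _ dJ).
  eexists; last first.
    rewrite (_ : (fun s => energy s - b * J s) = (fun s => energy s + - b * J s)).
      exact: D.
    by apply/funext => r; rewrite mulNr.
  have ws := w0 s s0.
  have : inner (xd s) (g s) <= b * (`|g s| / w s).
    apply: le_trans (inner_le_norm _ inn _ _) _.
    rewrite mulrA ler_pdivlMr// mulrAC ler_wpM2r// mulrC.
    exact: late_xd.
  have : 0 <= c / sg s * inner (xd s) (xd s).
    rewrite (inner_norm _ inn); apply: mulr_ge0; last exact: sqr_ge0.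
    by apply: divr_ge0; [exact: ltW|exact: le_trans (sg1 s s0)].
  by lra.
Qed.

Lemma late_lyap_d (t : R) : t1 <= t ->
  lyap_d t <= - (c / 2 * (1 + t) * `|xd t| ^+ 2) +
     C1 * (w t * `|g t| + sg t / (1 + t) ^+ 2).
Proof.
move=> tt; have [sc FB] := late t tt; have t0 := late_gt0 t tt.
apply: le_trans (lyap_d_le t t0 sc) _.
have k1 : 0 <= 16 / c by rewrite divr_ge0// ltW.
have s1 := sg1 t t0; have ws := w0 t t0.
rewrite lerD2l /C1 mulrAC ler_wpM2r//.
  apply: addr_ge0; first by apply: mulr_ge0 => //; exact: ltW.
  by apply: divr_ge0; [lra|exact: sqr_ge0].
by rewrite ler_wpM2l//; lra.
Qed.

(* The first two terms are s h' + c h, where h = |x|^2/2 + <x, x T>; [anchored_int]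
   collects the terms in W and J. *)
Definition anchored (T t : R) := sg t * (inner (x t) (xd t) + inner (x T) (xd t)) +
    c * (inner (x t) (x t) / 2 + inner (x T) (x t)) +
    A * lyap t + (A * C1 + C2) / (1 - alpha) * (sg t / (1 + t)) -
    b * J T * ((1 + t) * sg t).

Definition anchored_int (t : R) :=
  - (A * C1 + C2) * W t + b * ((1 + t) * sg t * J t).

Lemma derive_1p_sg (t : R) : 0 < t ->
  is_derive t 1 (fun s => (1 + s) * sg s) ((1 + alpha) * sg t).
Proof.
move=> t0; apply: is_derive_eq
  (is_derive_mul _ _ _ _ _ (is_derive_1p t) (dsg t t0)) _.
by field; rewrite gt_eqF//; lra.
Qed.

(** The increment of the product with [J] splits in two. The part with J v is controlled by the
    Lipschitz weight (1 + t) sg t. The part with J v - J u is at most b (W v - W u) by [WJ], and the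
    term in - W absorbs it because C2 >= b. *)
Lemma anchored_int_increment (t T : R) : t1 <= t -> t <= T ->
  forall u v, t <= u -> u <= v -> v <= T ->
  anchored_int v - anchored_int u <= b * K * (2 * (1 + T)) * (v - u).
Proof.
move=> tt tT u v tu uv vT; rewrite /anchored_int.
have [M0 b0 C10 A0 C20] := late_consts.
have u0 : 0 < u by apply: late_gt0; exact: le_trans tu.
have [_ _ Jv0 JvK] := WJK v.
have := WJ u v u0 uv; rewrite w2// => WJuv.
have lip1 : `|(1 + v) * sg v - (1 + u) * sg u| <= 2 * (1 + T) * (v - u).
  apply: (derive_bounded_lipschitz _ (fun s => (1 + s) * sg s)
    (fun s => (1 + alpha) * sg s) u v) => //.
    move=> s us sv; apply: derive_1p_sg; exact: lt_le_trans us.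
  move=> s us sv; have s0 : 0 < s by exact: lt_le_trans us.
  have s1 := sg1 s s0; have sl := sg_le s s0; have /andP[al0 al1] := alphaP.
  by rewrite ger0_norm ?mulr_ge0//; [apply: ler_pM; lra|lra|lra].
have H1 : ((1 + v) * sg v - (1 + u) * sg u) * J v <= 2 * (1 + T) * (v - u) * K.
  apply: le_trans (ler_norm _) _; rewrite normrM ler_pM//.
  by rewrite ger0_norm.
have H2 := ler_wpM2l b0 H1.
have H3 := ler_wpM2l b0 WJuv.
have H4 := ler_wpM2l (addr_ge0 (mulr_ge0 A0 C10) M0) (Wmon _ _ uv).
have H5 := ler_wpM2l M0 (Wmon _ _ uv).
by rewrite /C2; lra.
Qed.

Lemma anchored_le (t T : R) : t1 <= t -> t <= T ->
  anchored T T + anchored_int T <= anchored T t + anchored_int t.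
Proof.
move=> tt tT; have t0 := late_gt0 t tt; have T0 := lt_le_trans t0 tT.
have TT := le_trans tt tT.
have [M0 b0 C10 A0 C20] := late_consts.
have [W0T WKT J0T JKT] := WJK T.
have K0 : 0 <= K by exact: le_trans JKT.
have /andP[al0 al1] := alphaP.
apply: (@lip_nonincreasing R H xd t T (anchored T) anchored_int
  (b * K * (2 * (1 + T)))) => //.
- exact: xdac.
- by rewrite !mulr_ge0//; lra.
- have Lx := lip_x t T t0 tT; have Ld := lip_xd t T t0 tT.
  have LT : lip_along _ _ _ xd t T (fun=> x T) by exact: lip_cst.
  have Ls := lip_sg t T t0 tT.
  apply: lip_add; first apply: lip_add; first apply: lip_add; first apply: lip_add.
  + apply: lip_mul Ls _; apply: lip_add.
      exact: lip_inner inn Lx Ld.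
    exact: lip_inner inn LT Ld.
  + apply: lip_mulcl; apply: lip_add.
      by apply: lip_mul (lip_cst _ _); apply: lip_inner.
    exact: lip_inner inn LT Lx.
  + by apply: lip_mulcl; exact: lip_lyap.
  + by apply: lip_mulcl; exact: lip_sg_ratio.
  + rewrite (_ : (fun s => - (b * J T * ((1 + s) * sg s))) =
      (fun s => - (b * J T) * ((1 + s) * sg s))).
      by apply: lip_mulcl; apply: lip_mul Ls; exact: lip_1p.
    by apply/funext => s; rewrite mulNr.
- exact: anchored_int_increment.
apply: ae_impl ode _ => s gs ts sT.
have ss : t1 <= s by exact: le_trans ts.
have s0 := late_gt0 s ss; have {}gs := gs s0.
have [_ [_ _ dW dJ]] := gs.
have [xdd dxd xddE] := good_inner s s0 gs.
have dxT := is_derive_cst (x T) s 1.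
have dxx := is_derive_inner _ _ _ _ _ _ _ _ inn (dx s s0) (dx s s0).
have dxxd := is_derive_inner _ _ _ _ _ _ _ _ inn (dx s s0) dxd.
have dTx := is_derive_inner _ _ _ _ _ _ _ _ inn dxT (dx s s0).
have dTxd := is_derive_inner _ _ _ _ _ _ _ _ inn dxT dxd.
have dl := derive_1p_sg s s0.
have D1 := is_derive_mul _ _ _ _ _ (dsg s s0) (is_derive_add _ _ _ _ _ dxxd dTxd).
have D2 := is_derive_mulcl _ c _ _ (is_derive_add _ _ _ _ _
  (is_derive_mulcl _ (2^-1) _ _ dxx) dTx).
have D3 := is_derive_mulcl _ A _ _ (derive_lyap s s0 gs).
have D4 := is_derive_mulcl _ ((A * C1 + C2) / (1 - alpha)) _ _ (derive_sg_ratio s s0).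
have D5 := is_derive_mulcl _ (- (b * J T)) _ _ dl.
have D6 := is_derive_mulcl _ (- (A * C1 + C2)) _ _ dW.
have D7 := is_derive_mulcl _ b _ _ (is_derive_mul _ _ _ _ _ dl dJ).
have D := is_derive_add _ _ _ _ _ (is_derive_add _ _ _ _ _ (is_derive_add _ _ _ _ _
  (is_derive_add _ _ _ _ _ (is_derive_add _ _ _ _ _ D1 D2) D3) D4) D5)
  (is_derive_add _ _ _ _ _ D6 D7).
eexists; last first.
  apply: (eq_is_derive _ _ _ _ _ D) => r.
  by rewrite /anchored /anchored_int /= mulNr [inner _ _ / 2]mulrC.
have xs := late_x s ss; have xT := late_x T TT.
have ws := w0 s s0; have sgs := sg1 s s0; have sgl := sg_le s s0.
have := @anchored_derive_le R (1 + s) (sg s) (w s) c alpha M b C1 A C2 (lyap_d s)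
  `|xd s| `|g s| (J T - J s) (inner (x s) (xd s)) (inner (x T) (xd s))
  (inner (x s) (g s)) (inner (x T) (g s)) (inner (gradPhi (x s)) (x s))
  (inner (gradPhi (x s)) (x T)) alphaP c0 sgs sgl ws (w2 s s0) M0 b0
  (normr_ge0 _) (normr_ge0 _) _ (late_lyap_d s ss) _ _ _ _ _ erefl erefl.
rewrite subr_ge0 => /(_ (Jmon _ _ sT)).
have bd y z : `|y| <= M -> inner y z <= M * `|z|.
  by move=> yM; apply: le_trans (inner_le_norm _ inn _ _) _; rewrite ler_wpM2r.
move=> /(_ (bd _ _ xs) (bd _ _ xT) (bd _ _ xs) (bd _ _ xT)).
(* Evenness enters here: the gradient inequality at x s is tested at - x T, where [Phi] equals Phi
   (x T), and [energy_increment] bounds Phi (x T) - Phi (x s). *)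
have cvx : - (inner (gradPhi (x s)) (x s) + inner (gradPhi (x s)) (x T)) <=
    `|xd s| ^+ 2 / 2 + b * (J T - J s).
  have := convex_gradient_le Phi1 cPhi (x s) (- x T).
  rewrite evenPhi !(innerE _ inn).
  have := energy_increment s T ss sT; rewrite /energy !(inner_norm _ inn).
  have := sqr_ge0 `|xd T|; lra.
move=> /(_ cvx); apply: le_trans.
rewrite !xddE !(inner0l _ inn) /= (innerC _ inn (xd s) (x s)) !(inner_norm _ inn).
have wE : (1 + s) * sg s * (`|g s| / w s) = w s * `|g s|.
  by rewrite -w2//; field; rewrite gt_eqF.
rewrite wE le_eqVlt; apply/orP; left; apply/eqP.
by field; rewrite !gt_eqF//; lra.
Qed.

(** This is the function N of the overview: it depends on [t] alone and keeps the terms of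
    [anchored] and [anchored_int] that survive in the limit. *)
Definition lyap_limit (t : R) := c * `|x t| ^+ 2 + A * lyap t +
  (A * C1 + C2) * ((sg t / (1 + t)) / (1 - alpha) - W t).

(** For h = |x|^2/2 + <x, x T>, the difference c h(t) - c h(T) equals c |x t|^2 - c |x T|^2 - c/2 |x
    t - x T|^2, so [anchored_le] rearranges into a bound on the distance. The products with x' are
    at most M b sg / w and form the error. *)
Lemma late_dist (t T : R) : t1 <= t -> t <= T ->
  c / 2 * `|x t - x T| ^+ 2 <= lyap_limit t - lyap_limit T +
    2 * (M * b) * (sg t / w t + sg T / w T).
Proof.
move=> tt tT; have t0 := late_gt0 t tt; have T0 := lt_le_trans t0 tT.
have TT := le_trans tt tT.
have [M0 b0 C10 A0 C20] := late_consts.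
have := anchored_le t T tt tT; rewrite /anchored /anchored_int.
have xt := late_x t tt; have xT := late_x T TT.
have bd y s : t1 <= s -> `|y| <= M -> `|sg s * inner y (xd s)| <= M * b * (sg s / w s).
  move=> ss yM; have s0 := late_gt0 s ss; have ws := w0 s s0.
  have sg0 : 0 <= sg s by apply: le_trans (sg1 s s0).
  have H1 : w s * `|inner y (xd s)| <= M * b.
    apply: (@le_trans _ _ (`|y| * (w s * `|xd s|))).
      by rewrite mulrCA; apply: ler_wpM2l; [exact: ltW|exact: norm_inner_le].
    by apply: ler_pM => //; [apply: mulr_ge0 => //; exact: ltW|exact: late_xd].
  rewrite normrM (ger0_norm sg0) [leRHS]mulrCA; apply: ler_wpM2l => //.
  by rewrite ler_pdivlMr// mulrC.
have := bd _ t tt xt; have := bd _ t tt xT; have := bd _ T TT xT.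
rewrite !ler_norml => /andP[h1 h1'] /andP[h2 h2'] /andP[h3 h3'].
have Jt : 0 <= b * ((1 + t) * sg t * (J T - J t)).
  rewrite !mulr_ge0 ?subr_ge0 ?Jmon//; first by lra.
  exact: le_trans (sg1 t t0).
rewrite -(inner_norm _ inn (x t - x T)) !(innerE _ inn) (innerC _ inn (x t) (x T)).
rewrite /lyap_limit -!(inner_norm _ inn).
by move: h1 h1' h2 h2' h3 h3' Jt; lra.
Qed.

Lemma lyap_limit_ge (t : R) : t1 <= t -> - ((A * C1 + C2) * K) <= lyap_limit t.
Proof.
move=> tt; have t0 := late_gt0 t tt; have [sc _] := late t tt.
have [M0 b0 C10 A0 C20] := late_consts.
have [_ WKt _ _] := WJK t.
have C30 : 0 <= A * C1 + C2 by rewrite addr_ge0// mulr_ge0.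
have H1 : 0 <= c * `|x t| ^+ 2 by rewrite mulr_ge0 ?sqr_ge0// ltW.
have H2 : 0 <= lyap t.
  apply: le_trans (lyap_coercive t t0 sc).
  rewrite addr_ge0//; first by rewrite divr_ge0// sg_energy_ge0.
  by rewrite mulr_ge0 ?sqr_ge0// divr_ge0// ltW.
have H3 := mulr_ge0 A0 H2.
have /andP[r0 _] := sg_ratio_le1 t t0; have /andP[al0 al1] := alphaP.
have H4 : 0 <= sg t / (1 + t) / (1 - alpha) by rewrite divr_ge0//; lra.
have H5 : (A * C1 + C2) * - K <= (A * C1 + C2) * (sg t / (1 + t) / (1 - alpha) - W t).
  by rewrite ler_wpM2l//; lra.
by rewrite /lyap_limit; lra.
Qed.

End Late.

(** The square of sg t / w t is sg t / (1 + t), whence the tolerance r^2 passed to [sg_small]. *)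
Lemma sg_over_w_small (r : R) : 0 < r ->
  exists T : R, forall t, 0 < t -> T <= t -> sg t / w t <= r.
Proof.
move=> r0; have [|T TP] := sg_small (r ^+ 2); first exact: exprn_gt0.
exists T => t t0 Tt; have ws := w0 t t0; have s1 := sg1 t t0.
rewrite ler_pdivrMr// -(@ler_pXn2r _ 2)// ?nnegrE; [|by lra|by rewrite mulr_ge0// ltW].
rewrite exprMn w2// expr2 mulrA ler_wpM2r//; first by lra.
exact: TP.
Qed.

Lemma trajectory_asymptotics : exists (t1 lb B : R) (N e : R -> R), 0 < t1 /\
  [/\ forall t, t1 <= t -> lb <= N t,
      forall t T, t1 <= t -> t <= T ->
        c / 2 * `|x t - x T| ^+ 2 <= N t - N T + (e t + e T),
      forall r : R, 0 < r -> exists T, forall t, t1 <= t -> T <= t -> e t <= r &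
      forall t, t1 <= t -> (1 + t) * (Phi (x t) - Phi 0) <= B].
Proof.
have [t1 [B [t10 B0 late]]] := lyap_bounded.
have [M0 b0 C10 A0 C20] := late_consts B B0.
set M := 1 + 8 / c * B in M0; set b := 1 + 4 * B in b0.
have k0 : 0 <= 2 * (M * b) by rewrite !mulr_ge0.
exists t1; eexists; exists (2 * B), (lyap_limit B).
exists (fun t => 2 * (M * b) * (sg t / w t)); split => //; split.
- exact: (lyap_limit_ge t1 B).
- by move=> t T tt tT; rewrite -mulrDr; exact: (late_dist t1 B).
- move=> r r0; have k1 : 0 < 2 * (M * b) + 1 by lra.
  have [|T TP] := sg_over_w_small (r / (2 * (M * b) + 1)); first exact: divr_gt0.
  exists T => t tt Tt; have t0 := lt_le_trans t10 tt.
  have sw0 : 0 <= sg t / w t.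
    by apply: divr_ge0; [apply: le_trans (sg1 t t0)|exact/ltW/w0].
  have := TP t t0 Tt; rewrite ler_pdivlMr// mulrDr mulr1 mulrC; lra.
(* The bound on (1 + t) sg t E is used with sg t >= 1. *)
- move=> t tt; have t0 := lt_le_trans t10 tt.
  apply: le_trans (late_energy t1 B t10 late t tt); have s1 := sg1 t t0.
  have P0 := Phi0_min (x t).
  have e0 : Phi (x t) - Phi 0 <= energy t.
    by rewrite /energy (inner_norm _ inn) lerDr divr_ge0 ?sqr_ge0.
  rewrite -mulrA ler_wpM2l//; first by lra.
  by apply: (le_trans e0); rewrite ler_peMl//; lra.
Qed.

End Dynamics.

(** * Convergence *)

(** Past a time [t2] at which [N] is within [r] of its late infimum, N t2 - N t stays below [r];
    with small errors this keeps x t close to x t2, which is a Cauchy condition. *)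
Lemma quasi_monotone_cvg (R : realType) (H : completeNormedModType R) (x : R -> H)
    (N e : R -> R) (t1 k lb : R) : 0 < k ->
  (forall t, t1 <= t -> lb <= N t) ->
  (forall t T, t1 <= t -> t <= T ->
     k * `|x t - x T| ^+ 2 <= N t - N T + (e t + e T)) ->
  (forall r : R, 0 < r -> exists T, forall t, t1 <= t -> T <= t -> e t <= r) ->
  cvg (x t @[t --> +oo]).
Proof.
move=> k0 Nlb Nx e0; apply: cauchy_cvg; apply: cauchy_exP => eps eps0.
(* Three terms of size at most [r] add up below: the drop of [N] and the errors at the two times. *)
pose r := k * eps ^+ 2 / 4.
have r0 : 0 < r by rewrite divr_gt0// mulr_gt0// exprn_gt0.
have [T eT] := e0 r r0.
pose S := [set N t | t in [set t | t1 <= t /\ T <= t]].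
have infS : has_inf S.
  split; first by exists (N (Num.max t1 T)); exists (Num.max t1 T) => //=;
    rewrite !le_max !lexx orbT.
  by exists lb => _ [t [tt _] <-]; exact: Nlb.
have [_ [t2 [t12 Tt2] <-] Nt2] := inf_adherent r0 infS.
exists (x t2); exists t2; split; first exact: num_real.
move=> t /ltW t2t;  rewrite /= -ball_normE /=.
have tt : t1 <= t := le_trans t12 t2t.
have Tt : T <= t := le_trans Tt2 t2t.
have SN : inf S <= N t by apply: ge_inf; [exact: infS.2|exists t].
have := Nx t2 t t12 t2t; have := eT t2 t12 Tt2; have := eT t tt Tt.
move=> et et2 kx.
have : k * `|x t2 - x t| ^+ 2 < k * eps ^+ 2 by rewrite /r in r0 Nt2 et et2 *; lra.
by rewrite ltr_pM2l// ltr_pXn2r ?nnegrE ?normr_ge0 ?(ltW eps0).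
Qed.

(** * Powers of 1 + t *)

Section DampingWeight.
Context {R : realType}.
Implicit Types p q t : R.

Lemma powR_1p_ge1 p t : 0 <= p -> 0 < t -> 1 <= (1 + t) `^ p.
Proof. by move=> p0 t0; rewrite -[leLHS](powRr0 (1 + t)) ler_powR//; lra. Qed.

Lemma is_derive_powR_1p p t : 0 < t ->
  is_derive t 1 (fun s => (1 + s) `^ p) (p * ((1 + t) `^ p / (1 + t))).
Proof.
move=> t0; have t1 : 0 < 1 + t by lra.
have := @is_derive1_comp R (@powR R ^~ p) (fun s => 1 + s) t _ _
  (is_derive1_powR p t1) (is_derive_1p t).
by rewrite mulr1 powRB ?(gt_eqF t1) ?implybT// powRr1// ltW.
Qed.

Lemma powR_1p_small p (e : R) : p < 1 -> 0 < e ->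
  exists T : R, forall t : R, 0 < t -> T <= t -> (1 + t) `^ p <= e * (1 + t).
Proof.
move=> p1 e0; have q0 : 0 < 1 - p by lra.
(* This threshold is the solution of T^(1 - p) = 1/e. *)
exists (e^-1 `^ (1 - p)^-1) => t t0 Tt.
have t1 : 0 < 1 + t by lra.
have ei : e^-1 <= (1 + t) `^ (1 - p).
  have ie0 : 0 <= e^-1 by rewrite invr_ge0 ltW.
  have -> : e^-1 = (e^-1 `^ (1 - p)^-1) `^ (1 - p).
    by rewrite -powRrM mulVf ?gt_eqF// powRr1.
  by apply: ge0_ler_powR; rewrite ?nnegrE ?powR_ge0//; lra.
have -> : p = 1 - (1 - p) by lra.
rewrite powRB ?(gt_eqF t1) ?implybT// powRr1 ?(ltW t1)// mulrC.
rewrite ler_pM2r// -[leRHS]invrK lef_pV2 ?posrE ?invr_gt0// powR_gt0//.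
Qed.

Lemma sqr_powR_1p p t : 0 < t ->
  ((1 + t) `^ ((p + 1) / 2)) ^+ 2 = (1 + t) * (1 + t) `^ p.
Proof.
move=> t0; have t1 : 1 + t != 0 by rewrite gt_eqF; lra.
rewrite expr2 -powRD ?t1 ?implybT// (_ : (p + 1) / 2 + (p + 1) / 2 = 1 + p); last by lra.
by rewrite powRD ?t1 ?implybT// powRr1//; lra.
Qed.

Lemma measurable_powR_1p p : measurable_fun [set: R] (fun t => (1 + t) `^ p).
Proof.
apply: (measurableT_comp (measurable_powR p)).
exact: measurable_funD.
Qed.

End DampingWeight.

Theorem theorem4 (R : realType) (H : completeNormedModType R)
  (inner : H -> H -> R) (Phi : H -> R) (gradPhi : H -> H)
  (c alpha : R) (g x xd : R -> H) :
  is_inner_product inner ->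
  convex_fun Phi ->
  C1_with_gradient inner Phi gradPhi ->
  (exists v : H, forall y : H, Phi v <= Phi y) ->
  0 < c -> 0 <= alpha < 1 ->
  L1_pos g ->
  W21loc_pos x xd ->
  {ae (@lebesgue_measure R), forall t : R, 0 < t ->
     derivable xd t 1 /\
     'D_1 xd t + (c / (1 + t) `^ alpha) *: xd t + gradPhi (x t) = g t} ->
  (\int[(@lebesgue_measure R)]_(t in `]0%R, +oo[)
      ((1 + t) `^ ((alpha + 1) / 2) * `|g t|)%:E < +oo)%E ->
  (forall y : H, Phi (- y) = Phi y) ->
  exists2 xstar : H, (forall y : H, Phi xstar <= Phi y) &
    x t @[t --> +oo] --> xstar.
Proof.
move=> inn cPhi Phi1 _ c0 alphaP [gmeas _] [dx xdac] ode intg evenPhi.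
have /andP[al0 al1] := alphaP.
pose sg (t : R) := (1 + t) `^ alpha.
pose w (t : R) := (1 + t) `^ ((alpha + 1) / 2).
have p0 : 0 <= (alpha + 1) / 2 by lra.
have sg1 (t : R) : 0 < t -> 1 <= sg t by exact: powR_1p_ge1.
have sg_le (t : R) : 0 < t -> sg t <= 1 + t.
  move=> t0; rewrite -[leRHS]powRr1; last by lra.
  by rewrite ler_powR//; lra.
have dsg (t : R) : 0 < t -> is_derive t 1 sg (alpha * (sg t / (1 + t))).
  exact: is_derive_powR_1p.
have w0 (t : R) : 0 < t -> 0 < w t by move=> t0; rewrite powR_gt0; lra.
have w2 (t : R) : 0 < t -> w t ^+ 2 = (1 + t) * sg t by exact: sqr_powR_1p.
have sg_small (e : R) : 0 < e ->
    exists T : R, forall t : R, 0 < t -> T <= t -> sg t <= e * (1 + t).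
  exact: powR_1p_small.
have mwV : measurable_fun [set: R] (fun t => (w t)^-1).
  by rewrite /w; under eq_fun do rewrite -powRN; exact: measurable_powR_1p.
have wmon (u v : R) : 0 < u -> u <= v -> w u <= w v.
  by move=> u0 uv; rewrite /w ge0_ler_powR// ?nnegrE; lra.
have [W [J [Wmon Jmon [K WJK] WJ Wae]]] := weighted_primitives _ _ g w gmeas
  (measurable_powR_1p _) mwV (fun t => powR_1p_ge1 _ t p0) wmon intg.
have gd : {ae (@lebesgue_measure R), forall t : R, 0 < t ->
    good gradPhi c g x xd sg w W J t}.
  apply: ae_impl (ae_and _ _ _ ode Wae) _ => t [ot Wt] t0.
  have [dxd odet] := ot t0; have [dW dJ] := Wt t0.
  exists ('D_1 xd t); split => //.
  by apply/eqP; rewrite eq_sym !subr_eq -odet addrAC.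
have [t1 [lb [B [N [e [t10 [Nlb Nx e0 PhiB]]]]]]] :=
  trajectory_asymptotics inner Phi gradPhi c alpha g x xd sg w W J K
  inn cPhi Phi1 evenPhi c0 alphaP dx xdac sg1 sg_le dsg w0 w2 sg_small
  Wmon Jmon WJK WJ gd.
have /cvg_ex[l xl] : cvg (x t @[t --> +oo]).
  by apply: (quasi_monotone_cvg _ _ x N e t1 (c / 2) lb) => //; rewrite divr_gt0.
(* The limit is a minimizer: Phi (x t) tends to Phi l by continuity, while (1 + t) (Phi (x t) - Phi
   0) stays bounded, so Phi l <= Phi 0 + r for every r > 0. *)
exists l => // y; apply: (@le_trans _ _ (Phi 0)); last exact: Phi0_min.
apply/ler_addgt0Pl => r r0.
have Phil : Phi (x t) @[t --> +oo] --> Phi l.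
  apply: continuous_cvg xl; exact/differentiable_continuous/(Phi1.1 l).1.
move/cvgrPdist_lt : Phil => /(_ (r / 2)); rewrite divr_gt0// => /(_ isT)[T [_ TP]].
(* The second entry makes B <= t r / 2, and T + 1 puts [t] strictly beyond [T]; each of the two
   errors is then at most r / 2. *)
pose t := Num.max (Num.max t1 (2 * B / r)) (T + 1).
have tt : t1 <= t by rewrite !le_max lexx.
have tB : 2 * B / r <= t by rewrite !le_max lexx orbT.
have tT : T < t by rewrite lt_max ltrDl ltr01 orbT.
have t0 : 0 < t := lt_le_trans t10 tt.
have := TP t tT; rewrite /= ltr_distl => /andP[_].
have PB := PhiB t tt; rewrite ler_pdivrMr// in tB.
have : (1 + t) * (Phi (x t) - Phi 0) <= (1 + t) * (r / 2).
  by apply: (le_trans PB); have := mulr_ge0 (ltW t0) (ltW r0); lra.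
by rewrite ler_pM2l; lra.
Qed.
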